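(* Let $\mathcal{A}$ be a unital $C^*$-algebra. If $F \in B^a(H_{\mathcal{A}})$ belongs to the (topological, with respect to the operator norm) boundary of $\mathcal{M}\Phi(H_{\mathcal{A}})$ in $B^a(H_{\mathcal{A}})$, then $F \notin \mathcal{M}\Phi_{\pm}(H_{\mathcal{A}})$.
   Context: $\mathcal{A}$ is a unital $C^*$-algebra; $H_{\mathcal{A}} = \ell^2(\mathcal{A})$ is the standard Hilbert $\mathcal{A}$-module, and $B^a(H_{\mathcal{A}})$ is the $C^*$-algebra of bounded adjointable $\mathcal{A}$-linear operators on it. $M \tilde\oplus N$ denotes a direct sum of closed submodules that is not necessarily orthogonal. A Hilbert module is finitely generated if it is the (algebraic) $\mathcal{A}$-linear span of a finite set. An isomorphism of Hilbert modules is a bounded $\mathcal{A}$-linear bijection (with bounded inverse). For $F \in B^a(H_{\mathcal{A}})$ consider closed submodules with $H_{\mathcal{A}} = M_1 \tilde\oplus N_1 = M_2 \tilde\oplus N_2$, $F(M_1) \subseteq M_2$, $F(N_1) \subseteq N_2$ and $F|_{M_1}: M_1 \to M_2$ an isomorphism. $F \in \mathcal{M}\Phi_+(H_{\mathcal{A}})$ if such a decomposition exists with $N_1$ finitely generated; $F \in \mathcal{M}\Phi_-(H_{\mathcal{A}})$ if such a decomposition exists with $N_2$ finitely generated; $F \in \mathcal{M}\Phi(H_{\mathcal{A}})$ if a single such decomposition exists with both $N_1$ and $N_2$ finitely generated. $\mathcal{M}\Phi_{\pm}(H_{\mathcal{A}}) = \mathcal{M}\Phi_+(H_{\mathcal{A}})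 \cup \mathcal{M}\Phi_-(H_{\mathcal{A}})$. *)

(* Defs.v *)
From HB Require Import structures.
From mathcomp Require Import all_boot all_order all_algebra.
From mathcomp Require Import complex.
From mathcomp Require Import all_classical all_reals all_analysis.

Set Implicit Arguments.
Unset Strict Implicit.
Unset Printing Implicit Defensive.

Import Order.TTheory GRing.Theory Num.Theory.
Import numFieldNormedType.Exports.

Local Open Scope classical_set_scope.
Local Open Scope ring_scope.

(* The multiplication is part of this mixin because Hierarchy-Builder has no
   common substructure of rings and normed modules to join along (numDomainType
   is already declared above both); the ring structure is recovered below.  The
   zero algebra is allowed. *)
HB.mixin Record isCStarAlgebra (R : realType) A
    & CompleteNormedModule R[i] A := {
  cstar_one : A ;
  cstar_mul : A -> A -> A ;
  cstar_mulA : associative cstar_mul ;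
  cstar_mul1r : left_id cstar_one cstar_mul ;
  cstar_mulr1 : right_id cstar_one cstar_mul ;
  cstar_mulDl : left_distributive cstar_mul +%R ;
  cstar_mulDr : right_distributive cstar_mul +%R ;
  cstar_scaleAl : forall (c : R[i]) (x y : A),
    c *: cstar_mul x y = cstar_mul (c *: x) y ;
  cstar_scaleAr : forall (c : R[i]) (x y : A),
    c *: cstar_mul x y = cstar_mul x (c *: y) ;
  star : A -> A ;
  starK : involutive star ;
  star_semilinear : forall (c : R[i]) (x y : A),
    star (c *: x + y) = conjc c *: star x + star y ;
  starM : forall x y : A, star (cstar_mul x y) = cstar_mul (star y) (star x) ;
  cstar_norm_mul_le : forall x y : A, `|cstar_mul x y| <= `|x| * `|y| ;
  cstar_norm_star_mul : forall x : A, `|cstar_mul (star x) x| = `|x| ^+ 2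
}.

#[short(type="cstarAlgType")]
HB.structure Definition CStarAlgebra (R : realType) :=
  {A of CompleteNormedModule R[i] A & isCStarAlgebra R A}.

HB.instance Definition _ (R : realType) (A : cstarAlgType R) :=
  GRing.Zmodule_isPzRing.Build A (@cstar_mulA R A) (@cstar_mul1r R A)
    (@cstar_mulr1 R A) (@cstar_mulDl R A) (@cstar_mulDr R A).

Section DistanceTopology.
Context (R : realType) (T : Type) (d : T -> T -> R).

Definition dist_open : set_system T :=
  [set U | forall x, U x -> exists2 e : R, 0 < e & forall y, d x y < e -> U y].

Lemma dist_openT : dist_open setT.
Proof. by move=> x _; exists 1. Qed.

Lemma dist_openI : setI_closed dist_open.
Proof.
move=> U V oU oV x [/oU[e e0 eU] /oV[e' e0' eV]].
exists (Num.min e e'); first by rewrite lt_min e0.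
by move=> y; rewrite lt_min => /andP[/eU ? /eV ?]; split.
Qed.

Lemma dist_open_bigU (I : Type) (f : I -> set T) :
  (forall i, dist_open (f i)) -> dist_open (\bigcup_i f i).
Proof.
move=> of_ x [i _ /of_[e e0 ef]]; exists e => // y /ef fy.
by exists i.
Qed.

End DistanceTopology.

Section StandardModule.
Context (R : realType) (A : cstarAlgType R).

(* The inner product is conjugate-linear in its first argument, so that the
   standard module is a right A-module. *)
Definition inner (x y : nat -> A) : A :=
  limn (series (fun n => star (x n) * y n)).

(* Norms over R[i] take their (real) values in R[i], hence the Re. *)
Definition hnorm (x : nat -> A) : R :=
  Num.sqrt (complex.Re `|inner x x|).

(* The module operations are those of nat -> A; that ell2 is stable under them
   is a theorem, so they are expressed below coordinatewise, in relational
   form ("z is x a + y"), rather than as operations on ell2. *)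
Record ell2 := Ell2 {
  ell2_seq :> nat -> A ;
  ell2_summable : cvgn (series (fun n => star (ell2_seq n) * ell2_seq n))
}.

HB.instance Definition _ := gen_eqMixin ell2.
HB.instance Definition _ := gen_choiceMixin ell2.

Definition ell2_dist (x y : ell2) : R := hnorm (fun n => x n - y n).

HB.instance Definition _ := isOpenTopological.Build ell2
  (@dist_openT R ell2 ell2_dist) (@dist_openI R ell2 ell2_dist)
  (@dist_open_bigU R ell2 ell2_dist).

Definition submodule (M : set ell2) : Prop :=
  (forall z : ell2, (forall n, z n = 0) -> M z) /\
  (forall (x y z : ell2) (a : A), M x -> M y ->
     (forall n, z n = x n * a + y n) -> M z).

(* C-linearity is A-linearity for the scalars c *: 1. *)
Definition linear_on (M : set ell2) (f : ell2 -> ell2) : Prop :=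
  forall (x y z : ell2) (a : A), M x -> M y -> M z ->
    (forall n, z n = x n * a + y n) -> forall n, f z n = f x n * a + f y n.

Definition bounded_on (M : set ell2) (f : ell2 -> ell2) : Prop :=
  exists c : R, forall x, M x -> hnorm (f x) <= c * hnorm x.

Definition isomorphism (M N : set ell2) (f : ell2 -> ell2) : Prop :=
  [/\ linear_on M f, bounded_on M f, set_bij M N f &
      exists2 g : ell2 -> ell2, bounded_on N g & {in M, cancel f g}].

Definition finitely_generated (N : set ell2) : Prop :=
  exists (k : nat) (g : 'I_k -> ell2),
    N = [set x : ell2 | exists a : 'I_k -> A,
                          forall n, x n = \sum_(i < k) g i n * a i].

(* H_A is the not necessarily orthogonal direct sum of the closed submodules
   M and N. *)
Definition direct_sum (M N : set ell2) : Prop :=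
  [/\ submodule M /\ closed M, submodule N /\ closed N,
      forall z : ell2, exists x y : ell2,
        [/\ M x, N y & forall n, z n = x n + y n] &
      forall z : ell2, M z -> N z -> forall n, z n = 0].

Record adjointable := Adjointable {
  adjointable_fun :> ell2 -> ell2 ;
  adjointable_linear : linear_on setT adjointable_fun ;
  adjointable_bounded : bounded_on setT adjointable_fun ;
  adjointable_adjoint : exists G : ell2 -> ell2,
    forall x y : ell2, inner (adjointable_fun x) y = inner x (G y)
}.

HB.instance Definition _ := gen_eqMixin adjointable.
HB.instance Definition _ := gen_choiceMixin adjointable.

(* The operator norm of F - G. *)
Definition op_dist (F G : adjointable) : R :=
  sup [set hnorm (fun n => F x n - G x n) | x in [set x : ell2 | hnorm x <= 1]].

HB.instance Definition _ := isOpenTopological.Build adjointable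
  (@dist_openT R adjointable op_dist) (@dist_openI R adjointable op_dist)
  (@dist_open_bigU R adjointable op_dist).

Definition decomposition (F : adjointable) (M1 N1 M2 N2 : set ell2) : Prop :=
  [/\ direct_sum M1 N1, direct_sum M2 N2, F @` M1 `<=` M2, F @` N1 `<=` N2 &
      isomorphism M1 M2 F].

Definition MPhi_plus : set adjointable :=
  [set F | exists M1 N1 M2 N2,
             decomposition F M1 N1 M2 N2 /\ finitely_generated N1].

Definition MPhi_minus : set adjointable :=
  [set F | exists M1 N1 M2 N2,
             decomposition F M1 N1 M2 N2 /\ finitely_generated N2].

Definition MPhi : set adjointable :=
  [set F | exists M1 N1 M2 N2,
             [/\ decomposition F M1 N1 M2 N2, finitely_generated N1 &
                 finitely_generated N2]].

Definition MPhi_pm : set adjointable := MPhi_plus `|` MPhi_minus.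

End StandardModule.

Arguments MPhi_plus {R} A.
Arguments MPhi_minus {R} A.
Arguments MPhi {R} A.
Arguments MPhi_pm {R} A.

Definition boundary (T : topologicalType) (S : set T) : set T :=
  closure S `\` interior S.

(* Main.v *)
Require Import Defs.
From HB Require Import structures.
From mathcomp Require Import all_boot all_order all_algebra.
From mathcomp Require Import complex.
From mathcomp Require Import all_classical all_reals all_analysis.
From mathcomp Require Import lra ring.

(** The idea is that the finiteness of one summand, together with membership in
    [MPhi], forces the finiteness of the other one.

    Let [F] have a decomposition [M1 + N1 -> M2 + N2]. Every [G] close to [F]
    has the decomposition [M1 + G^-1 N2 -> G M1 + N2]
    ([decomposition_perturb]). The new first complement is again a complement
    of [M1], so it is finitely generated if and only if [N1] is, both conditions
    being about the quotient by [M1]; the last summand [N2] is unchanged. Hence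
    [MPhi] is open.

    If moreover [G] is in [MPhi], then for any decomposition of [G] the module
    [N1] is finitely generated if and only if [N2] is
    ([MPhi_finitely_generated_codomain], [MPhi_finitely_generated_domain]).
    This is pure algebra: a complement of [M] is finitely generated as soon as
    finitely many vectors generate it modulo [M], and such vectors are found by
    transporting generators along [G]. Consequently an operator of [MPhi_plus]
    or [MPhi_minus] with operators of [MPhi] arbitrarily close to it is itself
    in [MPhi], an open set, and so it is not on the boundary.

    The perturbation statement needs the standard module to be a Banach space,
    to get bounded projections onto closed summands from Baire's theorem
    ([closed_complement_bounded]) and to invert operators close to the identity.
    The triangle inequality and completeness of [ell2] in turn rest on the
    order of the C*-algebra: positivity of [a^* a] ([pos_starM]) and
    monotonicity of the norm on positive elements ([nrm_pos_mono]), both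
    obtained from square roots. *)

Set Implicit Arguments.
Unset Strict Implicit.
Unset Printing Implicit Defensive.

Import Order.TTheory GRing.Theory Num.Theory.
Import numFieldNormedType.Exports.

Local Open Scope classical_set_scope.
Local Open Scope complex_scope.
Local Open Scope ring_scope.

(** * The norm and the scalars of a C*-algebra *)

Section CStarNorm.
Context {R : realType} {A : cstarAlgType R}.
Implicit Types (a b c x y h : A) (t r : R).

(** The norm has values in [R[i]]; its real part carries the same information
    in an ordered field. *)
Definition nrm a : R := complex.Re `|a|.

Lemma nrmE a : `|a| = (nrm a)%:C.
Proof.
have /ger0_real : 0 <= `|a| by [].
rewrite /nrm; case: (`|a|) => u v /=; rewrite complex_real /= => /eqP ->.
by [].
Qed.

Lemma nrm_ge0 a : 0 <= nrm a.
Proof. by have := normr_ge0 a; rewrite nrmE lecR. Qed.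

Lemma nrm0 : nrm (0 : A) = 0.
Proof. by rewrite /nrm normr0. Qed.

Lemma nrm0_eq0 a : nrm a = 0 -> a = 0.
Proof. by move=> a0; apply: normr0_eq0; rewrite nrmE a0. Qed.

Lemma ler_nrmD a b : nrm (a + b) <= nrm a + nrm b.
Proof. by have := ler_normD a b; rewrite !nrmE -rmorphD lecR. Qed.

Lemma nrmN a : nrm (- a) = nrm a.
Proof. by rewrite /nrm normrN. Qed.

Lemma nrmB a b : nrm (a - b) = nrm (b - a).
Proof. by rewrite -nrmN opprB. Qed.

Lemma ler_nrmM a b : nrm (a * b) <= nrm a * nrm b.
Proof. by have := cstar_norm_mul_le a b; rewrite !nrmE -rmorphM lecR. Qed.

Lemma nrm_starM a : nrm (star a * a) = nrm a ^+ 2.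
Proof. by have := cstar_norm_star_mul a; rewrite !nrmE -rmorphXn => -[]. Qed.

Lemma starD a b : star (a + b) = star a + star b.
Proof. by have := star_semilinear 1 a b; rewrite conjc1 !scale1r. Qed.

Lemma star0 : star (0 : A) = 0.
Proof. by apply: (addrI (star 0)); rewrite -starD !addr0. Qed.

Lemma starZ (c : R[i]) a : star (c *: a) = conjc c *: star a.
Proof. by have := star_semilinear c a 0; rewrite star0 !addr0. Qed.

Lemma starN a : star (- a) = - star a.
Proof. by apply/eqP; rewrite -addr_eq0 -starD addNr star0. Qed.

Lemma starB a b : star (a - b) = star a - star b.
Proof. by rewrite starD starN. Qed.

Lemma starMr a b : star (a * b) = star b * star a.
Proof. exact: starM. Qed.

Lemma star1 : star (1 : A) = 1.
Proof. by rewrite -[LHS]mulr1 -{2}[1]starK -starMr mulr1 starK. Qed.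

Lemma nrm_star a : nrm (star a) = nrm a.
Proof.
suff le_star b : nrm b <= nrm (star b).
  by apply/eqP; rewrite eq_le le_star -{2}[a]starK le_star.
have [->|b0] := eqVneq (nrm b) 0; first exact: nrm_ge0.
have b_gt0 : 0 < nrm b by rewrite lt_def b0 nrm_ge0.
by rewrite -(ler_pM2r b_gt0) -expr2 -nrm_starM ler_nrmM.
Qed.

Lemma nrm_sq h : star h = h -> nrm (h * h) = nrm h ^+ 2.
Proof. by move=> hE; rewrite -nrm_starM hE. Qed.

Lemma nrm1_le1 : nrm (1 : A) <= 1.
Proof.
have := nrm_starM 1; rewrite star1 mul1r => /eqP.
have := nrm_ge0 1; move: (nrm 1) => n n0; nra.
Qed.

(** The central copy of the real scalars: it lets all identities be computed
    in the ring structure of [A] alone. *)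
Definition sc t : A := t%:C *: (1 : A).

Lemma scMl t a : sc t * a = t%:C *: a.
Proof. by rewrite -{2}[a]mul1r; exact/esym/cstar_scaleAl. Qed.

Lemma scMr t a : a * sc t = t%:C *: a.
Proof. by rewrite -{2}[a]mulr1; exact/esym/cstar_scaleAr. Qed.

Lemma scC t a : a * sc t = sc t * a.
Proof. by rewrite scMl scMr. Qed.

Lemma scD t r : sc (t + r) = sc t + sc r.
Proof. by rewrite /sc rmorphD scalerDl. Qed.

Lemma scM t r : sc (t * r) = sc t * sc r.
Proof. by rewrite scMl /sc rmorphM scalerA. Qed.

Lemma sc0 : sc 0 = 0.
Proof. by rewrite /sc scale0r. Qed.

Lemma sc1 : sc 1 = 1.
Proof. by rewrite /sc scale1r. Qed.

Lemma star_sc t : star (sc t) = sc t.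
Proof. by rewrite /sc starZ star1 conjc_real. Qed.

Lemma nrm_scM t a : nrm (sc t * a) = `|t| * nrm a.
Proof.
rewrite scMl /nrm normrZ nrmE normc_def /= expr0n addr0 sqrtr_sqr.
by rewrite mul0r subr0.
Qed.

Lemma nrm_sc t : 0 <= t -> nrm (sc t) <= t.
Proof.
move=> t0; rewrite -[sc t]mulr1 nrm_scM ger0_norm//.
by rewrite -[leRHS]mulr1 ler_wpM2l// nrm1_le1.
Qed.

Definition im : A := 'i *: (1 : A).

Lemma imMl a : im * a = 'i *: a.
Proof. by rewrite -{2}[a]mul1r; exact/esym/cstar_scaleAl. Qed.

Lemma imC a : a * im = im * a.
Proof. by rewrite imMl -{2}[a]mulr1; exact/esym/cstar_scaleAr. Qed.

Lemma im_sq : im * im = -1.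
Proof. by rewrite imMl /im scalerA -expr2 sqr_i scaleN1r. Qed.

Lemma star_im : star im = - im.
Proof.
rewrite /im starZ star1 -scaleNr; congr (_ *: _).
by apply/eqP; rewrite eq_complex /= oppr0 !eqxx.
Qed.

Lemma nrm_imM a : nrm (im * a) = nrm a.
Proof.
rewrite imMl /nrm normrZ normc_def /=.
by rewrite expr0n add0r expr1n sqrtr1 mul1r.
Qed.

(** Convergence with real tolerances, since those of the topology of [A] are
    elements of [R[i]]. *)
Definition tends (u : nat -> A) a :=
  forall e, 0 < e -> exists N, forall n, (N <= n)%N -> nrm (u n - a) <= e.

Lemma tendsP (u : nat -> A) a : u @ \oo --> a <-> tends u a.
Proof.
split=> [/cvgrPdist_le ua e e0|ua].
  have /ua [N _ uN] : 0 < e%:C by rewrite ltcR.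
  by exists N => n /uN; rewrite /= nrmE lecR nrmB.
apply/cvgrPdist_le => e e0.
have e0R : e = (complex.Re e)%:C.
  by move: e0; case: e => p q; rewrite ltcE /= => /andP[/eqP-> _].
have /ua [N uN] : 0 < complex.Re e by move: e0; rewrite e0R ltcR.
by exists N => // n /uN ?; rewrite e0R nrmE lecR nrmB.
Qed.

Lemma nrm_cauchy (u : nat -> A) :
  (forall e, 0 < e ->
    exists N, forall m n, (N <= m)%N -> (m <= n)%N -> nrm (u n - u m) <= e) <->
  exists a, tends u a.
Proof.
split=> [uC|[a ua] e e0]; last first.
  have /ua [N uN] : 0 < e / 2 by rewrite divr_gt0.
  exists N => m n Nm mn; rewrite -(subrKA a) (le_trans (ler_nrmD _ _))//.
  have := uN _ Nm; have := uN _ (leq_trans Nm mn).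
  rewrite [nrm (a - _)]nrmB; lra.
suff /cvg_ex[a /tendsP ua] : cvgn u by exists a.
apply/cauchy_cvgP/cauchy_exP => e e0.
have e0R : e = (complex.Re e)%:C.
  by move: e0; case: e => p q; rewrite ltcE /= => /andP[/eqP-> _].
have eR : 0 < complex.Re e by move: e0; rewrite e0R ltcR.
have /uC [N uN] : 0 < complex.Re e / 2 by rewrite divr_gt0.
exists (u N), N => // n Nn; rewrite /= -ball_normE /=.
rewrite e0R nrmE ltcR nrmB (le_lt_trans (uN _ _ _ Nn))//; lra.
Qed.

End CStarNorm.

(** * Square roots *)

Section Limits.
Context {R : realType} {A : cstarAlgType R}.
Implicit Types (u v : nat -> A) (a b : A).

Lemma nrm_small a : (forall e : R, 0 < e -> nrm a <= e) -> a = 0.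
Proof.
move=> a0; apply/nrm0_eq0/eqP; rewrite eq_le nrm_ge0 andbT.
by apply/ler_addgt0Pr => e /a0; rewrite add0r.
Qed.

Lemma tends_unique u a b : tends u a -> tends u b -> a = b.
Proof.
move=> ua ub; apply/subr0_eq/nrm_small => e e0.
have e2 : 0 < e / 2 by rewrite divr_gt0.
have [N uN] := ua _ e2; have [M uM] := ub _ e2.
have := uN _ (leq_maxl N M); have := uM _ (leq_maxr N M).
move: (maxn N M) => n.
move=> ? ?; rewrite -(subrKA (u n)); rewrite (le_trans (ler_nrmD _ _))//.
by rewrite (nrmB a); lra.
Qed.

Lemma tends_cst a : tends (fun=> a) a.
Proof. by move=> e e0; exists 0%N => n _; rewrite subrr nrm0 ltW. Qed.

Lemma tends_shift u a : tends u a -> tends (fun n => u n.+1) a.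
Proof. by move=> ua e /ua[N uN]; exists N => n Nn; exact/uN/leqW. Qed.

Lemma tendsD u v a b :
  tends u a -> tends v b -> tends (fun n => u n + v n) (a + b).
Proof.
move=> ua vb e e0; have e2 : 0 < e / 2 by rewrite divr_gt0.
have [N uN] := ua _ e2; have [M vM] := vb _ e2.
exists (maxn N M) => n; rewrite geq_max => /andP[/uN ? /vM ?].
by rewrite opprD addrACA (le_trans (ler_nrmD _ _))//; lra.
Qed.

Lemma tendsM u v a b :
  tends u a -> tends v b -> tends (fun n => u n * v n) (a * b).
Proof.
move=> ua vb e e0.
pose c := nrm a + nrm b + 1.
have c0 : 0 < c by rewrite /c; have := nrm_ge0 a; have := nrm_ge0 b; lra.
pose d := Num.min 1 (e / (2 * c)).
have d0 : 0 < d by rewrite lt_min ltr01 divr_gt0// mulr_gt0.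
have d1 : d <= 1 by rewrite ge_min lexx.
have dc : d * c <= e / 2.
  have : d <= e / (2 * c) by rewrite ge_min lexx orbT.
  by rewrite invfM mulrA ler_pdivlMr.
have [N uN] := ua _ d0; have [M vM] := vb _ d0.
exists (maxn N M) => n; rewrite geq_max => /andP[/uN un /vM vn].
have -> : u n * v n - a * b = (u n - a) * v n + a * (v n - b).
  by rewrite mulrBl mulrBr subrKA.
rewrite (le_trans (ler_nrmD _ _))//.
have v_le : nrm (v n) <= c.
  rewrite -(subrK b (v n)) (le_trans (ler_nrmD _ _))//.
  by have := nrm_ge0 a; rewrite /c; lra.
have a_le : nrm a <= c by have := nrm_ge0 b; rewrite /c; lra.
have := ler_nrmM (u n - a) (v n); have := ler_nrmM a (v n - b).
have := ler_pM (nrm_ge0 _) (nrm_ge0 _) un v_le.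
have := ler_pM (nrm_ge0 _) (nrm_ge0 _) a_le vn.
rewrite [c * d]mulrC; lra.
Qed.

Lemma tends_star u a : tends u a -> tends (fun n => star (u n)) (star a).
Proof.
by move=> ua e /ua[N uN]; exists N => n /uN; rewrite -starB nrm_star.
Qed.

Lemma tends_nrm_le u a (c : R) N : tends u a ->
  (forall n, (N <= n)%N -> nrm (u n) <= c) -> nrm a <= c.
Proof.
move=> ua uc; apply/ler_addgt0Pr => e /ua[M uM].
have := uM _ (leq_maxr N M); have := uc _ (leq_maxl N M).
move: (maxn N M) => n ? ?; rewrite -(subrK (u n) a).
by rewrite (le_trans (ler_nrmD _ _))// (nrmB a); lra.
Qed.

End Limits.

Section SquareRoot.
Context {R : realType} {A : cstarAlgType R}.

(** [1 - sqrt (1 - z)] is the fixed point [y = (z + y ^ 2) / 2]. The scalar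
    iteration for [z = 1] is bounded and dominates the one for any [z] of norm
    at most [1]. *)
Fixpoint majorant n : R :=
  if n is m.+1 then 2^-1 * (1 + majorant m * majorant m) else 0.

Fixpoint sqrt_approx (z : A) n : A :=
  if n is m.+1 then sc 2^-1 * (z + sqrt_approx z m * sqrt_approx z m) else 0.

Lemma majorant_itv n : 0 <= majorant n <= 1.
Proof. by elim: n => [|n /andP[? ?]] /=; [lra | apply/andP; split; nra]. Qed.

Lemma majorant_nondecreasing n : majorant n <= majorant n.+1.
Proof. by move: (majorant_itv n) => /= /andP[? ?]; nra. Qed.

Lemma majorant_cauchy (e : R) : 0 < e ->
  exists N, forall m n, (N <= m)%N -> (m <= n)%N ->
    majorant n - majorant m <= e.
Proof.
move=> e0; have ndt : nondecreasing_seq majorant.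
  by apply/nondecreasing_seqP => n; exact: majorant_nondecreasing.
have ubt : has_ubound (range majorant).
  by exists 1 => _ [n _ <-]; have /andP[] := majorant_itv n.
have /(_ ndt ubt) := @nondecreasing_cvgn R majorant.
move=> /cvgrPdist_le /(_ _ e0)[N _ tN].
exists N => m n Nm mn; have := tN _ Nm => /=.
rewrite ler_norml => /andP[_ le_e].
have n_le : majorant n <= sup (range majorant).
  by apply: sup_ubound => //; exists n.
lra.
Qed.

Variables (z : A) (z1 : nrm z <= 1).

Lemma nrm_sqrt_approx n : nrm (sqrt_approx z n) <= majorant n.
Proof.
elim: n => [|n IH] /=; first by rewrite nrm0.
rewrite nrm_scM ger0_norm ?invr_ge0// ler_wpM2l ?invr_ge0//.
rewrite (le_trans (ler_nrmD _ _))// lerD//.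
by rewrite (le_trans (ler_nrmM _ _))// ler_pM// nrm_ge0.
Qed.

(** In both iterations an increment is half of a difference of squares, which
    factors through the previous increment. *)
Lemma nrm_sqrt_approxB n :
  nrm (sqrt_approx z n.+1 - sqrt_approx z n) <= majorant n.+1 - majorant n.
Proof.
elim: n => [|n IH].
  rewrite /= !subr0 !mulr0 !addr0 nrm_scM ger0_norm ?invr_ge0//.
  by rewrite ler_wpM2l ?invr_ge0.
set y := sqrt_approx z n.+1 in IH *; set x := sqrt_approx z n in IH *.
have -> : sqrt_approx z n.+2 - y = sc 2^-1 * (y * (y - x) + (y - x) * x).
  rewrite {2}/y /= -/y -/x -mulrBr; congr (_ * _).
  by rewrite opprD addrACA subrr add0r mulrBr mulrBl subrKA.
have -> : majorant n.+2 - majorant n.+1 =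
    2^-1 * (majorant n.+1 * (majorant n.+1 - majorant n) +
            (majorant n.+1 - majorant n) * majorant n).
  have majorantS k : majorant k.+1 = 2^-1 * (1 + majorant k * majorant k) by [].
  rewrite (majorantS n.+1); move: (majorantS n).
  by move: (majorant n) (majorant n.+1) => x0 y0; lra.
rewrite nrm_scM ger0_norm ?invr_ge0// ler_wpM2l ?invr_ge0//.
rewrite (le_trans (ler_nrmD _ _))// lerD//.
  by rewrite (le_trans (ler_nrmM _ _))// ler_pM ?nrm_ge0 ?nrm_sqrt_approx.
by rewrite (le_trans (ler_nrmM _ _))// ler_pM ?nrm_ge0 ?nrm_sqrt_approx.
Qed.

Lemma sqrt_approx_cvg : exists y, tends (sqrt_approx z) y.
Proof.
apply/nrm_cauchy => e /majorant_cauchy[N tN]; exists N => m n Nm mn.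
apply: le_trans (tN _ _ Nm mn); rewrite -(subnK mn).
elim: (n - m)%N => [|k IH]; first by rewrite !subrr nrm0.
rewrite addSn -(subrKA (sqrt_approx z (k + m))) -(subrKA (majorant (k + m))).
by rewrite (le_trans (ler_nrmD _ _))// lerD// nrm_sqrt_approxB.
Qed.


(** The root commutes with the whole commutant of [z]: it is a limit of
    polynomials in [z]. *)
Lemma sqrt_one_sub : star z = z ->
  exists s : A, [/\ star s = s, s * s = 1 - z, nrm (1 - s) <= 1 &
    forall x, x * z = z * x -> x * s = s * x].
Proof.
move=> sz; have [y yl] := sqrt_approx_cvg.
have ylS := tends_shift yl.
have yE : y = sc 2^-1 * (z + y * y).
  by apply: (tends_unique ylS); apply: tendsM; [exact: tends_cst|];
    apply: tendsD; [exact: tends_cst|exact: tendsM].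
have zE : z = y + y - y * y.
  apply/eqP; rewrite eq_sym subr_eq; apply/eqP; rewrite {1 2}yE.
  by rewrite -mulrDl -scD (_ : 2^-1 + 2^-1 = 1) ?sc1 ?mul1r//; lra.
have ysa : star y = y.
  apply: (tends_unique (tends_star yl)).
  suff -> : (fun n => star (sqrt_approx z n)) = sqrt_approx z by [].
  apply/funext; elim=> [|n IH] /=; first by rewrite star0.
  by rewrite starMr star_sc starD starMr IH sz scC.
exists (1 - y); split.
- by rewrite starB star1 ysa.
- rewrite zE mulrBl mul1r mulrBr mulr1 !opprB opprD !addrA.
  by rewrite (addrAC 1).
- rewrite opprB addrC subrK; apply: (tends_nrm_le (N := 0) yl) => n _.
  by rewrite (le_trans (nrm_sqrt_approx n))//; have /andP[] := majorant_itv n.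
- move=> x xz; rewrite mulrBl mulrBr mul1r mulr1; congr (_ - _).
  apply: (tends_unique (tendsM (tends_cst x) yl)).
  suff -> : (fun n => x * sqrt_approx z n) = (fun n => sqrt_approx z n * x).
    exact: (tendsM yl (tends_cst x)).
  apply/funext; elim=> [|n IH] /=; first by rewrite mulr0 mul0r.
  by rewrite mulrA scC -!mulrA mulrDr mulrDl xz mulrA IH -!mulrA IH.
Qed.

End SquareRoot.

(** * Positive elements *)

Section Positivity.
Context {R : realType} {A : cstarAlgType R}.
Implicit Types (a b c h p q x : A) (t : R).

(** Positivity expressed by the norm instead of the spectrum: for a self-
    adjoint [a] with spectrum in [[-t, t]], the distance from [t] to [a] is
    at most [t] exactly when the spectrum is nonnegative. Stability under
    sums is then the triangle inequality. *)
Definition pos a := star a = a /\ exists t, nrm (sc t - a) <= t.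

Lemma pos0 : pos (0 : A).
Proof. by split; [exact: star0|exists 0; rewrite sc0 subrr nrm0]. Qed.

Lemma posD a b : pos a -> pos b -> pos (a + b).
Proof.
move=> [sa [t ta]] [sb [r rb]]; split; first by rewrite starD sa sb.
exists (t + r); rewrite scD opprD addrACA.
by rewrite (le_trans (ler_nrmD _ _))// lerD.
Qed.

Lemma pos_sum (I : Type) (s : seq I) (P : pred I) (f : I -> A) :
  (forall i, P i -> pos (f i)) -> pos (\sum_(i <- s | P i) f i).
Proof. by move=> pf; elim/big_ind : _ => //; [exact: pos0|exact: posD]. Qed.

(** After rescaling, [p / r = 1 - z] with [z] of norm at most [1]. *)
Lemma pos_sqrt p : pos p ->
  exists s, [/\ pos s, s * s = p & forall x, x * p = p * x -> x * s = s * x].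
Proof.
move=> [sp [t tp]].
have t0 : 0 <= t := le_trans (nrm_ge0 _) tp.
pose r := t + 1; have r0 : 0 < r by rewrite ltr_wpDl.
have rp : nrm (sc r - p) <= r.
  rewrite /r scD addrAC (le_trans (ler_nrmD _ _))// lerD//.
  exact: nrm_sc.
pose z := sc r^-1 * (sc r - p).
have rr : r^-1 * r = 1 by rewrite mulVf ?gt_eqF.
have rVr : sc r * sc r^-1 = 1 :> A by rewrite -scM mulrC rr sc1.
have z1 : nrm z <= 1.
  have rV0 : 0 <= r^-1 by rewrite invr_ge0 ltW.
  by rewrite nrm_scM ger0_norm// -[leRHS]rr ler_wpM2l.
have sz : star z = z by rewrite starMr starB !star_sc sp scC.
have zE : 1 - z = sc r^-1 * p.
  by rewrite /z mulrBr -scM rr sc1 opprB addrC subrK.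
have [s [ss s2 s1 sC]] := sqrt_one_sub z1 sz.
pose w := Num.sqrt r; have ww : w * w = r by rewrite -expr2 sqr_sqrtr// ltW.
have scs : sc w * s * (sc w * s) = p.
  by rewrite mulrA -(mulrA _ s) scC !mulrA -scM ww -mulrA s2 zE mulrA rVr mul1r.
exists (sc w * s); split=> //.
  split; first by rewrite starMr star_sc ss scC.
  exists w; rewrite -[X in X - _]mulr1 -mulrBr nrm_scM ger0_norm ?sqrtr_ge0//.
  by rewrite -[leRHS]mulr1 ler_wpM2l ?sqrtr_ge0.
move=> x xp; rewrite mulrA scC -!mulrA sC//.
by rewrite /z mulrA scC -!mulrA mulrBr mulrBl xp scC.
Qed.

(** The element [u = h + i s] satisfies [u^* u = t], and [s] is its imaginary
    part, hence of norm at most [sqrt t]. *)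
Lemma nrm_commuting_squares h s t : star h = h -> star s = s ->
  h * s = s * h -> h * h + s * s = sc t -> 0 <= t -> nrm (s * s) <= t.
Proof.
move=> sh ss hs hst t0; pose u := h + im * s.
have su : star u = h - im * s by rewrite starD starMr star_im sh ss mulrN imC.
have uu : star u * u = sc t.
  rewrite su /u mulrBl !mulrDr -hst.
  have -> : im * s * (im * s) = - (s * s).
    by rewrite mulrA -(mulrA im s) imC !mulrA im_sq mulN1r mulNr.
  have -> : h * (im * s) = im * s * h by rewrite mulrA imC -!mulrA hs.
  by rewrite opprD opprK addrA addrK.
have nu : nrm u ^+ 2 <= t by rewrite -nrm_starM uu nrm_sc.
rewrite nrm_sq// (le_trans _ nu)// lerXn2r ?nnegrE ?nrm_ge0//.
have : nrm (im * s + im * s) <= nrm u + nrm u.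
  have -> : im * s + im * s = u - star u.
    by rewrite su /u opprB [RHS]addrC addrA subrK.
  by rewrite -{2}[nrm u]nrm_star -[nrm (star u)]nrmN ler_nrmD.
rewrite -[im * s]mulr1 -mulrDr -(sc1 (A := A)) -scD scC nrm_scM nrm_imM.
by rewrite ger0_norm//; lra.
Qed.

(** With [t = |h ^ 2|], the element [t - h ^ 2] is visibly positive; its
    square root [s] commutes with [h] and [h ^ 2 + s ^ 2 = t]. *)
Lemma pos_sq h : star h = h -> pos (h * h).
Proof.
move=> sh; split; first by rewrite starMr sh.
pose t := nrm (h * h); have t0 : 0 <= t := nrm_ge0 _.
have [|s [[ss _] s2 sC]] := @pos_sqrt (sc t - h * h).
  split; first by rewrite starB star_sc starMr sh.
  by exists t; rewrite opprB addrC subrK.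
exists t; rewrite -s2; apply: (nrm_commuting_squares (h := h)) => //.
  by apply: sC; rewrite mulrBr mulrBl scC mulrA.
by rewrite s2 addrC subrK.
Qed.

(** The square roots of [p] and [t - p] are commuting self-adjoint elements
    whose squares sum to [t]. *)
Lemma nrm_pos_le p t : pos p -> pos (sc t - p) -> 0 <= t -> nrm p <= t.
Proof.
move=> pp ptp t0.
have [s [[ss _] s2 sC]] := pos_sqrt pp.
have [w [[sw _] w2 wC]] := pos_sqrt ptp.
rewrite -s2; apply: (nrm_commuting_squares (h := w)) => //.
  by apply/esym/wC; rewrite mulrBr mulrBl scC -s2 mulrA.
by rewrite s2 w2 subrK.
Qed.

Lemma pos_antisym p : pos p -> pos (- p) -> p = 0.
Proof.
move=> pp pnp; apply/nrm0_eq0/eqP; rewrite eq_le nrm_ge0 andbT.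
by apply: nrm_pos_le; rewrite ?sc0 ?sub0r.
Qed.

(** This monotonicity replaces the comparison of sums of nonnegative numbers
    in all norm estimates on [ell2]. *)
Lemma nrm_pos_mono p q : pos p -> pos (q - p) -> nrm p <= nrm q.
Proof.
move=> pp pqp; apply: nrm_pos_le; rewrite ?nrm_ge0//.
rewrite -(subrKA q); apply: posD => //.
have [sq _] : pos q by rewrite -(subrK p q); exact: posD.
split; first by rewrite starB star_sc sq.
by exists (nrm q); rewrite opprB addrC subrK.
Qed.

Lemma sq_eq0 h : star h = h -> h * h = 0 -> h = 0.
Proof.
move=> sh hh; apply/nrm0_eq0/eqP; rewrite -sqrf_eq0 -nrm_sq// hh.
by rewrite nrm0.
Qed.

Lemma starM_eq0 c : star c * c = 0 -> c = 0.
Proof.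
by move=> cc; apply/nrm0_eq0/eqP; rewrite -sqrf_eq0 -nrm_starM cc nrm0.
Qed.

(** The sum is that of the squares of the self-adjoint elements [e + star e]
    and [i (e - star e)]. *)
Lemma pos_starM_sym e :
  pos (star e * e + e * star e + (star e * e + e * star e)).
Proof.
pose x := e + star e; pose y := im * (e - star e).
have sx : star x = x by rewrite starD starK addrC.
have sy : star y = y.
  by rewrite starMr starB starK star_im mulrN -mulNr opprB imC.
have xE : x * x = e * e + star e * star e + (star e * e + e * star e).
  by rewrite mulrDr !mulrDl (addrC (e * star e)) addrACA.
have yE : y * y = - (e * e + star e * star e) + (star e * e + e * star e).
  rewrite mulrA -(mulrA im) imC mulrA im_sq mulN1r mulNr.
  rewrite mulrBl !mulrBr !opprB addrACA addrC; congr (_ + _).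
  by rewrite opprD addrC.
have -> : star e * e + e * star e + (star e * e + e * star e) = x * x + y * y.
  by rewrite xE yE [RHS]addrACA subrr add0r.
by apply: posD; exact: pos_sq.
Qed.

(** This is the core of the Kelley-Vaught argument. With
    [s ^ 2 = - c^* c] and [e = c s], both [e^* e] and [e e^*] are minus a
    square, while their sum is positive. *)
Lemma neg_starM_eq0 c : pos (- (star c * c)) -> c = 0.
Proof.
move=> /pos_sqrt[s [[ss _] s2 _]].
pose q := c * star c; pose e := c * s; pose p := s * s.
have sq : star q = q by rewrite starMr starK.
have sp : star p = p by rewrite starMr ss.
have ccE : star c * c = - p by rewrite /p s2 opprK.
have e1 : star e * e = - (p * p).
  by rewrite starMr ss mulrA -(mulrA s) ccE mulrN mulNr /p !mulrA.
have e2 : e * star e = - (q * q).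
  rewrite starMr ss mulrA -(mulrA c) -/p.
  by rewrite -[p]opprK -ccE mulrN mulNr /q !mulrA.
have := pos_starM_sym e; rewrite e1 e2 -!opprD.
have pp := pos_sq sp; have qq := pos_sq sq.
move=> nw; have w0 := pos_antisym (posD (posD pp qq) (posD pp qq)) nw.
have q0 : q * q = 0.
  apply: pos_antisym => //; move/eqP: w0.
  rewrite addrA addr_eq0 => /eqP <-.
  by apply: posD => //; exact: posD.
by rewrite -[c]starK (starM_eq0 (c := star c)) ?star0// starK; exact: sq_eq0.
Qed.

(** Put [b = a^* a], let [m] be the absolute value of [b] and [d = m - b],
    twice the negative part of [b]. Then [b d = - m d], so [c = a d] has [c^*
    c] equal to minus a square; hence [c = 0], and this forces [d = 0]. *)
Lemma pos_starM a : pos (star a * a).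
Proof.
set b := star a * a; have sb : star b = b by rewrite starMr starK.
have [m [pm m2 mC]] := pos_sqrt (pos_sq sb).
have [s [[ss _] s2 sC]] := pos_sqrt pm.
have bm : b * m = m * b by apply: mC; rewrite mulrA.
have [sm _] := pm.
pose d := m - b; have sd : star d = d by rewrite starB sm sb.
have bd : b * d = - (m * d) by rewrite /d !mulrBr bm m2 opprB.
have sdC : s * d = d * s.
  have dm : d * m = m * d by rewrite /d mulrBr mulrBl bm.
  exact/esym/sC.
have ssd : star (s * d) = s * d by rewrite starMr ss sd sdC.
have cc : star (a * d) * (a * d) = - (s * d * (s * d)).
  rewrite starMr sd mulrA -(mulrA d) -/b -mulrA bd mulrN {1}sdC -s2.
  by rewrite !mulrA.
have ad0 : a * d = 0.
  by apply: neg_starM_eq0; rewrite cc opprK; exact: pos_sq.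
have sd0 : s * d = 0.
  apply: sq_eq0 => //; apply/eqP; rewrite -oppr_eq0 -cc ad0 mulr0.
  by [].
have md0 : m * d = 0 by rewrite -s2 -mulrA sd0 mulr0.
have d0 : d = 0.
  by apply: sq_eq0 => //; rewrite {1}/d mulrBl md0 bd md0 oppr0 subrr.
by rewrite (_ : b = m)//; apply/eqP; rewrite eq_sym -subr_eq0 -/d d0.
Qed.

End Positivity.

(** * Norm estimates for square-summable sequences *)

Section PartialSums.
Context {R : realType} {A : cstarAlgType R}.
Implicit Types (x y : nat -> A) (a b : A) (m n : nat).

Definition psq x m n : A := \sum_(m <= i < n) star (x i) * x i.

Definition sq_summable x := cvgn (series (fun n => star (x n) * x n)).

Lemma psq_pos x m n : pos (psq x m n).
Proof. by apply: pos_sum => i _; exact: pos_starM. Qed.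

Lemma psq_cat x m n p : (m <= n)%N -> (n <= p)%N ->
  psq x m p = psq x m n + psq x n p.
Proof. by move=> mn np; rewrite /psq (big_cat_nat mn np). Qed.

Lemma psq_mono x m n p : (n <= p)%N -> nrm (psq x m n) <= nrm (psq x m p).
Proof.
move=> np; have [mn|nm] := leqP m n; last first.
  by rewrite {1}/psq big_geq ?nrm0 ?nrm_ge0// ltnW.
apply: nrm_pos_mono; first exact: psq_pos.
by rewrite (psq_cat _ mn np) addrC addKr; exact: psq_pos.
Qed.

Lemma psq_tail x m n : nrm (psq x m n) <= nrm (psq x 0 n).
Proof.
have [mn|/ltnW nm] := leqP m n; last first.
  by rewrite {1}/psq big_geq ?nrm0 ?nrm_ge0.
apply: nrm_pos_mono; first exact: psq_pos.
by rewrite (psq_cat _ (leq0n m) mn) addrK; exact: psq_pos.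
Qed.

Lemma sq_summableP x : sq_summable x <->
  forall e : R, 0 < e -> exists N, forall m n,
    (N <= m)%N -> (m <= n)%N -> nrm (psq x m n) <= e.
Proof.
have xE m n : (m <= n)%N -> psq x m n = psq x 0 n - psq x 0 m.
  by move=> mn; rewrite (psq_cat _ (leq0n m) mn) addrC addKr.
transitivity (exists a, tends (psq x 0) a).
  split=> [/cvg_ex[a /tendsP]|[a /tendsP xa]]; first by exists a.
  by apply/cvg_ex; exists a.
rewrite -nrm_cauchy; split=> xC e /xC[N xN]; exists N => m n Nm mn.
  by rewrite xE ?xN.
by rewrite -xE ?xN.
Qed.

Lemma tends_inner x : sq_summable x -> tends (psq x 0) (inner x x).
Proof. by move=> xs; exact/tendsP. Qed.

(** The partial inner squares increase, so the norm is the supremum of their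
    square roots: inequalities between norms reduce to finite sums. *)
Lemma hnormP x (c : R) : sq_summable x -> 0 <= c ->
  hnorm x <= c <-> forall n, nrm (psq x 0 n) <= c ^+ 2.
Proof.
move=> xs c0; have xl := tends_inner xs.
have -> : (hnorm x <= c) = (nrm (inner x x) <= c ^+ 2).
  by rewrite -(ler_sqrt _ (exprn_ge0 2 c0)) sqrtr_sqr ger0_norm.
split=> [xc n|xc]; last exact: (tends_nrm_le (N := 0) xl).
apply: le_trans xc; apply/ler_addgt0Pr => e /xl[N xN].
rewrite (le_trans (psq_mono x 0 (leq_maxl n N)))//.
rewrite -(subrK (inner x x) (psq _ _ _)) (le_trans (ler_nrmD _ _))//.
by rewrite addrC lerD2l xN// leq_maxr.
Qed.

Lemma hnorm_ge0 x : 0 <= hnorm x.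
Proof. exact: sqrtr_ge0. Qed.

Lemma psq_le_hnorm x m n : sq_summable x -> nrm (psq x m n) <= hnorm x ^+ 2.
Proof.
move=> xs; rewrite (le_trans (psq_tail _ _ _))//.
by move: n; apply/hnormP => //; exact: hnorm_ge0.
Qed.

Lemma psq_mulr x a m n :
  nrm (psq (fun i => x i * a) m n) <= nrm a ^+ 2 * nrm (psq x m n).
Proof.
have -> : psq (fun i => x i * a) m n = star a * psq x m n * a.
  rewrite /psq mulr_sumr mulr_suml; apply: eq_bigr => i _.
  by rewrite starMr !mulrA.
rewrite (le_trans (ler_nrmM _ _))// mulrC expr2 -mulrA.
rewrite ler_wpM2l ?nrm_ge0// (le_trans (ler_nrmM _ _))//.
by rewrite nrm_star.
Qed.

(** Before taking norms, the difference of the two sides is the inner square of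
    [t^(1/2) x - t^(-1/2) y]. Optimizing over [t] gives the triangle
    inequality. *)
Lemma psqD x y m n (t : R) : 0 < t ->
  nrm (psq (fun i => x i + y i) m n) <=
    (1 + t) * nrm (psq x m n) + (1 + t^-1) * nrm (psq y m n).
Proof.
move=> t0; pose w := Num.sqrt t.
have w0 : w != 0 by rewrite gt_eqF// sqrtr_gt0.
have ww : w * w = t by rewrite -expr2 sqr_sqrtr// ltW.
have wV : w^-1 * w^-1 = t^-1 by rewrite -invfM ww.
apply: (@le_trans _ _
    (nrm (sc (1 + t) * psq x m n + sc (1 + t^-1) * psq y m n))).
  apply: nrm_pos_mono; first exact: psq_pos.
  rewrite /psq !mulr_sumr -sumrN -!big_split/=; apply: pos_sum => i _.
  move: (x i) (y i) => a b.
  suff -> : sc (1 + t) * (star a * a) + sc (1 + t^-1) * (star b * b) -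
      star (a + b) * (a + b) =
      star (sc w * a - sc w^-1 * b) * (sc w * a - sc w^-1 * b).
    exact: pos_starM.
  rewrite starB !starMr !star_sc mulrBl !mulrBr.
  have scE (r s : R) (c d : A) :
      star c * sc r * (sc s * d) = sc (r * s) * (star c * d).
    by rewrite scC mulrA -(mulrA (sc r)) scC mulrA scM !mulrA.
  rewrite !scE ww wV mulfV// mulVf// sc1 !mul1r.
  rewrite !scD sc1 !mulrDl !mul1r starD mulrDl !mulrDr.
  rewrite (addrC (star b * a)) (addrACA (star a * a) (star a * b)).
  have cancel (X Y Z : A) : X + Y - (X + Z) = Y - Z.
    by rewrite opprD addrACA subrr add0r.
  by rewrite [X in X - _]addrACA cancel opprB opprD [LHS]addrACA.
rewrite (le_trans (ler_nrmD _ _))// lerD// nrm_scM ger0_norm//.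
  by rewrite addr_ge0// ltW.
by rewrite addr_ge0// invr_ge0 ltW.
Qed.

(** The optimal [t] is [b / a]; shifting both by [e] avoids division by zero. *)
Lemma le_sq_add (u a b : R) : 0 <= a -> 0 <= b ->
  (forall t, 0 < t -> u <= (1 + t) * a ^+ 2 + (1 + t^-1) * b ^+ 2) ->
  u <= (a + b) ^+ 2.
Proof.
move=> a0 b0 ut.
suff ue e : 0 < e -> u <= (a + b + e + e) ^+ 2.
  have [u0|u0] := ltP 0 u; last by rewrite (le_trans u0)// sqr_ge0.
  rewrite -(sqr_sqrtr (ltW u0)) lerXn2r ?nnegrE ?sqrtr_ge0 ?addr_ge0//.
  apply/ler_addgt0Pr => e e0.
  have e2 : 0 < e / 2 by rewrite divr_gt0.
  have e_ge0 := ltW e0.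
  have := ue _ e2; rewrite -{1}(sqr_sqrtr (ltW u0)) -(addrA (a + b)) -splitr.
  by rewrite ler_pXn2r ?nnegrE ?sqrtr_ge0 ?addr_ge0.
move=> e0.
have ae : 0 < a + e by rewrite ltr_wpDl.
have be : 0 < b + e by rewrite ltr_wpDl.
have t0 : 0 < (b + e) / (a + e) by rewrite divr_gt0.
rewrite (le_trans (ut _ t0))//.
apply: (@le_trans _ _ ((1 + (b + e) / (a + e)) * (a + e) ^+ 2 +
  (1 + ((b + e) / (a + e))^-1) * (b + e) ^+ 2)).
  rewrite lerD// ler_wpM2l ?addr_ge0 ?invr_ge0 ?(ltW t0)//.
    by rewrite lerXn2r ?nnegrE ?(ltW ae)// lerDl ltW.
  by rewrite lerXn2r ?nnegrE ?(ltW be)// lerDl ltW.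
rewrite le_eqVlt; apply/orP; left; apply/eqP; field.
by rewrite !gt_eqF.
Qed.

Lemma sq_summableD x y :
  sq_summable x -> sq_summable y -> sq_summable (fun n => x n + y n).
Proof.
move=> /sq_summableP xs /sq_summableP ys; apply/sq_summableP => e e0.
have e4 : 0 < e / 4 by rewrite divr_gt0.
have [N xN] := xs _ e4; have [M yM] := ys _ e4.
exists (maxn N M) => m n; rewrite geq_max => /andP[Nm Mm] mn.
have := psqD x y m n (ltr01 : 0 < 1 :> R); rewrite invr1.
have := xN _ _ Nm mn; have := yM _ _ Mm mn; lra.
Qed.

Lemma sq_summableMr x a : sq_summable x -> sq_summable (fun n => x n * a).
Proof.
move=> /sq_summableP xs; apply/sq_summableP => e e0.
have a0 : 0 < nrm a ^+ 2 + 1 by rewrite ltr_wpDl// sqr_ge0.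
have /xs[N xN] : 0 < e / (nrm a ^+ 2 + 1) by rewrite divr_gt0.
exists N => m n Nm mn; rewrite (le_trans (psq_mulr _ _ _ _))//.
have := xN _ _ Nm mn; rewrite ler_pdivlMr//; apply: le_trans.
by rewrite mulrC ler_wpM2l ?nrm_ge0// lerDl.
Qed.

Lemma sq_summable0 : sq_summable (fun=> 0 : A).
Proof.
apply/sq_summableP => e e0; exists 0%N => m n _ _.
by rewrite /psq big1 ?nrm0 ?ltW// => i _; rewrite mulr0.
Qed.

Lemma hnorm_add_le x y : sq_summable x -> sq_summable y ->
  hnorm (fun n => x n + y n) <= hnorm x + hnorm y.
Proof.
move=> xs ys; apply/hnormP; rewrite ?addr_ge0 ?hnorm_ge0//.
  exact: sq_summableD.
move=> n; apply: le_sq_add; rewrite ?hnorm_ge0// => t t0.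
rewrite (le_trans (psqD _ _ _ _ t0))//.
have t1 : 0 <= 1 + t by rewrite addr_ge0// ltW.
have tV1 : 0 <= 1 + t^-1 by rewrite addr_ge0// invr_ge0 ltW.
by rewrite lerD// ler_wpM2l// psq_le_hnorm.
Qed.

Lemma hnormMr x a :
  sq_summable x -> hnorm (fun n => x n * a) <= hnorm x * nrm a.
Proof.
move=> xs; apply/hnormP; rewrite ?mulr_ge0 ?hnorm_ge0 ?nrm_ge0//.
  exact: sq_summableMr.
move=> n; rewrite (le_trans (psq_mulr _ _ _ _))// exprMn mulrC.
by rewrite ler_wpM2r ?sqr_ge0// psq_le_hnorm.
Qed.

Lemma nrm_le_hnorm x n : sq_summable x -> nrm (x n) <= hnorm x.
Proof.
move=> xs; rewrite -(ler_pXn2r (n := 2))// ?nnegrE ?hnorm_ge0 ?nrm_ge0//.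
rewrite -nrm_starM; have := psq_le_hnorm n n.+1 xs.
by rewrite /psq big_nat1.
Qed.

End PartialSums.

(** * The standard module as a Banach space *)

Section Ell2Module.
Context {R : realType} {A : cstarAlgType R}.
Implicit Types (x y z : ell2 A) (a b : A).

Lemma mem_ell2 x : sq_summable x.
Proof. exact: ell2_summable. Qed.
Arguments mem_ell2 x : clear implicits.

Lemma ell2P x y : (forall n, x n = y n) -> x = y.
Proof.
case: x y => [x xs] [y ys] /= /funext xy; subst y.
by congr Ell2; exact: Prop_irrelevance.
Qed.

Definition ell2_mulr x a : ell2 A := Ell2 (sq_summableMr (a := a) (mem_ell2 x)).

Let ell2_add x y : ell2 A := Ell2 (sq_summableD (mem_ell2 x) (mem_ell2 y)).

Let ell2_zero : ell2 A := Ell2 sq_summable0.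

Let ell2_opp x := ell2_mulr x (-1).

Let ell2_addA : associative ell2_add.
Proof. by move=> x y z; apply: ell2P => n /=; rewrite addrA. Qed.

Let ell2_addC : commutative ell2_add.
Proof. by move=> x y; apply: ell2P => n /=; rewrite addrC. Qed.

Let ell2_add0 : left_id ell2_zero ell2_add.
Proof. by move=> x; apply: ell2P => n /=; rewrite add0r. Qed.

Let ell2_addN : left_inverse ell2_zero ell2_opp ell2_add.
Proof. by move=> x; apply: ell2P => n /=; rewrite mulrN1 addNr. Qed.

HB.instance Definition _ :=
  GRing.isZmodule.Build (ell2 A) ell2_addA ell2_addC ell2_add0 ell2_addN.

Lemma ell2_addE x y n : (x + y) n = x n + y n.
Proof. by []. Qed.

Lemma ell2_subE x y n : (x - y) n = x n - y n.
Proof. by rewrite ell2_addE /= mulrN1. Qed.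

Lemma ell2_sumE (I : Type) (s : seq I) (f : I -> ell2 A) n :
  (\sum_(i <- s) f i) n = \sum_(i <- s) f i n.
Proof. by elim/big_rec2 : _ => // i u v _ <-. Qed.

Lemma ell2_mulrD x y a : ell2_mulr (x + y) a = ell2_mulr x a + ell2_mulr y a.
Proof. by apply: ell2P => n; exact: mulrDl. Qed.

Lemma ell2_mulrN x a : ell2_mulr (- x) a = - ell2_mulr x a.
Proof. by apply: ell2P => n /=; rewrite !mulrN1 mulNr. Qed.

Lemma ell2_mulr0 x : ell2_mulr x 0 = 0.
Proof. by apply: ell2P => n; exact: mulr0. Qed.

Lemma ell2_mulr1 x : ell2_mulr x 1 = x.
Proof. by apply: ell2P => n; exact: mulr1. Qed.

Lemma hnorm_sub x y : hnorm (fun n => x n - y n) = hnorm (x - y).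
Proof. by congr hnorm; apply/funext => n; rewrite ell2_subE. Qed.

Lemma ler_hnormD x y : hnorm (x + y) <= hnorm x + hnorm y.
Proof. exact: (hnorm_add_le (mem_ell2 x) (mem_ell2 y)). Qed.

Lemma ler_hnormMr x a : hnorm (ell2_mulr x a) <= hnorm x * nrm a.
Proof. exact: (hnormMr a (mem_ell2 x)). Qed.

Lemma hnorm_zero : hnorm (0 : ell2 A) = 0.
Proof.
apply/eqP; rewrite eq_le hnorm_ge0 andbT.
by have := ler_hnormMr 0 0; rewrite ell2_mulr0 nrm0 mulr0.
Qed.

Lemma hnorm0_eq0 x : hnorm x = 0 -> x = 0.
Proof.
move=> x0; apply: ell2P => n; apply/nrm0_eq0/eqP.
by rewrite eq_le nrm_ge0 andbT -x0 nrm_le_hnorm//; exact: mem_ell2.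
Qed.

Lemma hnorm_opp x : hnorm (- x) = hnorm x.
Proof.
suff le_opp y : hnorm (- y) <= hnorm y.
  by apply/eqP; rewrite eq_le le_opp -{1}[x]opprK le_opp.
rewrite (le_trans (ler_hnormMr _ _))// nrmN -[leRHS]mulr1.
by rewrite ler_wpM2l ?hnorm_ge0// nrm1_le1.
Qed.

Lemma tends_psq (u : nat -> nat -> A) (l : nat -> A) m n :
  (forall i, tends (u^~ i) (l i)) -> tends (fun k => psq (u k) m n) (psq l m n).
Proof.
move=> ul; rewrite /psq; elim: (index_iota m n) => [|i s IH].
  by under eq_fun do rewrite big_nil; rewrite big_nil; exact: tends_cst.
under eq_fun do rewrite big_cons; rewrite big_cons.
by apply: tendsD => //; apply: tendsM => //; exact: tends_star.
Qed.

(** Bounded partial sums do not suffice for membership of the coordinatewise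
    limit: its tails are compared with those of an approximating sequence. *)
Lemma ell2_complete (u : nat -> ell2 A) :
  (forall e : R, 0 < e -> exists N, forall m n,
    (N <= m)%N -> (N <= n)%N -> hnorm (u m - u n) <= e) ->
  exists l, forall e : R, 0 < e -> exists N, forall n,
    (N <= n)%N -> hnorm (u n - l) <= e.
Proof.
move=> uC.
have /choice[l ul] : forall i, exists a, tends (fun k => u k i) a.
  move=> i; apply/nrm_cauchy => e /uC[N uN]; exists N => m n Nm mn.
  rewrite -ell2_subE (le_trans (nrm_le_hnorm _ (mem_ell2 _)))//.
  by rewrite uN// (leq_trans Nm).
(* A bound on u k - u j for all large j passes to the limit in j, and it is
   uniform in the range of the partial sum. *)
have u_l e : 0 < e -> exists N, forall k m n, (N <= k)%N ->
    nrm (psq (fun i => u k i - l i) m n) <= e ^+ 2.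
  move=> e0; have [N uN] := uC _ e0; exists N => k m n Nk.
  have /(_ m n) := @tends_psq (fun j i => u k i - u j i) (fun i => u k i - l i).
  have kl i : tends (fun j => u k i - u j i) (u k i - l i).
    apply: tendsD; first exact: tends_cst.
    by move=> d /(ul i)[M uM]; exists M => j /uM; rewrite -opprD nrmN.
  move=> /(_ kl) /(tends_nrm_le (N := N)); apply => j Nj.
  have := psq_le_hnorm m n (mem_ell2 (u k - u j)).
  rewrite (_ : psq _ _ _ = psq (fun i => u k i - u j i) m n); last first.
    by congr psq; apply/funext => i; rewrite ell2_subE.
  move=> /le_trans; apply; rewrite lerXn2r ?nnegrE ?hnorm_ge0 ?(ltW e0)//.
  exact: uN.
have ls : sq_summable l.
  apply/sq_summableP => e e0.
  have d0 : 0 < Num.sqrt (e / 4) by rewrite sqrtr_gt0 divr_gt0.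
  have [K uK] := u_l _ d0.
  have /sq_summableP/(_ (e / 4)) [|N uN] := mem_ell2 (u K).
    by rewrite divr_gt0.
  exists N => m n Nm mn.
  have := psqD (u K) (fun i => (u K i - l i) * (-1)) m n (ltr01 : 0 < 1 :> R).
  have -> : (fun i => u K i + (u K i - l i) * (-1)) = l.
    by apply/funext => i; rewrite mulrN1 opprB addrC subrK.
  have := psq_mulr (fun i => u K i - l i) (-1) m n.
  have nN1 : nrm (-1 : A) ^+ 2 <= 1.
    by rewrite nrmN expr_le1 ?nrm_ge0// nrm1_le1.
  have := uK K m n (leqnn K); rewrite sqr_sqrtr ?divr_ge0 ?(ltW e0)//.
  have := uN _ _ Nm mn; rewrite invr1.
  have := nrm_ge0 (psq (fun i => u K i - l i) m n).
  have := sqr_ge0 (nrm (-1 : A)); nra.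
exists (Ell2 ls) => e e0; have [N uN] := u_l _ e0.
exists N => k Nk; apply/hnormP; rewrite ?(ltW e0)//; first exact: mem_ell2.
move=> n; rewrite (_ : psq _ _ _ = psq (fun i => u k i - l i) 0 n) ?uN//.
by congr psq; apply/funext => i; rewrite ell2_subE.
Qed.

End Ell2Module.

(** A copy of [ell2] on which the Banach space structure of the norm is
    declared, since [ell2] already carries the topology of its distance. *)
Definition hilbert (R : realType) (A : cstarAlgType R) : Type := ell2 A.

Section Hilbert.
Context {R : realType} {A : cstarAlgType R}.
Local Notation H := (hilbert A).

HB.instance Definition _ := GRing.Zmodule.copy H (ell2 A).

Let scale (r : R) (x : H) : H := ell2_mulr x (sc r).

Let scaleA r s (x : H) : scale r (scale s x) = scale (r * s) x.
Proof. by apply: ell2P => n /=; rewrite scM -mulrA scC. Qed.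

Let scale1 : left_id 1 scale.
Proof. by move=> x; rewrite /scale sc1; exact: ell2_mulr1. Qed.

Let scaleDr : right_distributive scale +%R.
Proof. by move=> r x y; exact: ell2_mulrD. Qed.

Let scaleDl (x : H) : {morph scale^~ x : r s / r + s}.
Proof. by move=> r s; apply: ell2P => n /=; rewrite scD mulrDr. Qed.

HB.instance Definition _ :=
  GRing.Zmodule_isLmodule.Build R H scaleA scale1 scaleDr scaleDl.

Let hilbert_norm (x : H) : R := hnorm x.

Let hilbert_normZ r (x : H) : hilbert_norm (r *: x) = `|r| * hilbert_norm x.
Proof.
have le_scale s (y : H) : hilbert_norm (s *: y) <= `|s| * hilbert_norm y.
  rewrite (le_trans (ler_hnormMr _ _))// mulrC ler_wpM2r ?hnorm_ge0//.
  have := nrm_scM s (1 : A); rewrite mulr1 => ->.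
  by rewrite -[leRHS]mulr1 ler_wpM2l// nrm1_le1.
apply/eqP; rewrite eq_le le_scale/=.
have [->|r0] := eqVneq r 0; first by rewrite normr0 mul0r hnorm_ge0.
rewrite mulrC -ler_pdivlMr ?normr_gt0// mulrC -normfV.
by rewrite -{1}[x]scale1r -(mulVf r0) -scalerA le_scale.
Qed.

HB.instance Definition _ := @Lmodule_isNormed.Build R H
  hilbert_norm ler_hnormD hilbert_normZ hnorm0_eq0.

Lemma hilbert_normE (x : H) : `|x| = hnorm x.
Proof. by []. Qed.

Lemma hnorm_scale (r : R) (x : ell2 A) :
  hnorm (ell2_mulr x (sc r)) = `|r| * hnorm x.
Proof. exact: hilbert_normZ. Qed.

Let hilbert_complete (F : set_system H) : ProperFilter F -> cauchy F -> cvg F.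
Proof.
move=> FF /cauchyP FC.
pose e k : R := k.+1%:R^-1.
have e0 k : 0 < e k by rewrite invr_gt0.
have /choice[u Fu] : forall k, exists x, F (ball x (e k)).
  by move=> k; exact: FC.
have uu j k : hnorm (u j - u k) <= e j + e k.
  have [z [jz kz]] := filter_ex (filterI (Fu j) (Fu k)).
  move: jz kz; rewrite -!ball_normE /= => jz kz.
  rewrite -(hilbert_normE (u j - u k)) -(subrKA z).
  by rewrite (le_trans (ler_normD _ _))// lerD// ltW// distrC.
have eN d : 0 < d -> exists N, forall k, (N <= k)%N -> e k <= d.
  move=> d0; have [N _ eN] := near_infty_natSinv_lt (PosNum d0).
  by exists N => k /eN /ltW.
have [|l ul] := @ell2_complete _ _ u.
  move=> d d0; have /eN[N dN] : 0 < d / 2 by rewrite divr_gt0.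
  exists N => j k /dN ? /dN ?; rewrite (le_trans (uu _ _))//; lra.
apply/cvg_ex; exists l; apply/cvgrPdist_le => d d0.
have d2 : 0 < d / 2 by rewrite divr_gt0.
have [N dN] := eN _ d2; have [M ulM] := ul _ d2.
have := dN _ (leq_maxl N M); have := ulM _ (leq_maxr N M).
move: (maxn N M) => k ulk ek.
apply: filterS (Fu k) => z; rewrite -ball_normE /= => uz.
rewrite -(subrKA (u k)) (le_trans (ler_normD _ _))//.
rewrite [X in X + _]distrC {1}hilbert_normE; lra.
Qed.

HB.instance Definition _ := Uniform_isComplete.Build H hilbert_complete.

End Hilbert.

(** * Complemented subspaces of Banach spaces *)

Section Banach.
Context {R : realType} {V : completeNormedModType R}.
Implicit Types (x y z w : V) (M N : set V).

(** Baire's theorem for a countable cover: some closure has an interior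
    point. *)
Lemma Baire_closure (C : nat -> set V) : (forall z, exists k, C k z) ->
  exists k z (r : R), [/\ 0 < r & forall w, `|w| < r -> closure (C k) (z + w)].
Proof.
move=> C_all.
have [k nd] : exists k, ~ dense (~` closure (C k)).
  apply: contrapT => /forallNP all_dense.
  have : dense (\bigcap_i (~` closure (C i))).
    apply: Baire => i; split; last exact: contrapT (all_dense i).
    exact/closed_openC/closed_closure.
  move=> /(_ setT) [||z [_ zC]]; [by exists 0|exact: openT|].
  by have [k kz] := C_all z; apply: (zC k) => //; exact: subset_closure.
have [U [[z [Uo Uz]] U0]] := denseNE nd.
have /nbhs_ballP[r /= r0 rU] : nbhs z U by exact: open_nbhs_nbhs.
exists k, z, r; split=> // w wr; apply: contrapT => wC.
suff : (U `&` ~` closure (C k)) (z + w) by rewrite U0.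
split=> //; apply: rU.
by rewrite -ball_normE /= opprD addrA subrr add0r normrN.
Qed.

Lemma closure_approx (C : set V) z (d : R) : 0 < d -> closure C z ->
  exists2 c, C c & `|z - c| <= d.
Proof.
move=> d0 /(_ (ball z d)) [|c [Cc]]; first exact: nbhsx_ballx.
by rewrite -ball_normE /= => /ltW ?; exists c.
Qed.

(** The unknown [y] is the fixed point of [y |-> z - k y]. *)
Lemma contraction_add_surj (k : V -> V) (q : R) : 0 <= q -> q < 1 ->
  (forall x y, `|k x - k y| <= q * `|x - y|) -> forall z, exists y, z = y + k y.
Proof.
move=> q0 q1 kq z.
pose f : V -> V := fun y => z - k y.
have [|||y _ yE] := @banach_fixed_point R V setT (totalfun_ setT f).
- exists (NngNum q0); split=> // -[x y] _ /=.
  by rewrite /totalfun_ /f opprB addrC subrKA distrC kq.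
- exact: closedT.
- by exists 0.
by exists y; rewrite {1}yE /totalfun_ /f subrK.
Qed.

Lemma geometric_cvg (s : nat -> V) (c : R) (P : set V) : closed P -> 0 <= c ->
  (forall n, `|s n| <= c * 2^-1 ^+ n) -> (forall n, P (series s n)) ->
  exists x, [/\ P x, `|x| <= 2 * c & series s @ \oo --> x].
Proof.
move=> Pc c0 sc sP.
have h1 : `|2^-1 : R| < 1 by rewrite ger0_norm ?invr_ge0//; lra.
have gc := @is_cvg_geometric_series R c _ h1.
have nc : cvgn [normed series s].
  apply: (series_le_cvg _ _ _ gc) => n //=.
  by rewrite mulr_ge0// exprn_ge0// invr_ge0.
have cs := normed_cvg nc.
exists (limn (series s)); split=> //.
  by apply: (closed_cvg P Pc _ _ cs); exact: nearW.
rewrite (le_trans (lim_series_norm nc))//.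
have := lim_series_le nc gc sc => /le_trans; apply.
rewrite (cvg_lim _ (cvg_geometric_series h1))//.
by rewrite (_ : 1 - 2^-1 = 2^-1) ?invrK 1?mulrC//; lra.
Qed.

(** The open mapping theorem for the sum map from [M * N], which yields the
    bounded projection onto [M] along [N]. By Baire's theorem, sums of
    [k]-bounded vectors approximate every vector of some ball; iterating on
    the error gives geometric series in [M] and in [N]. *)
Lemma closed_complement_bounded M N :
  closed M -> closed N -> M 0 -> N 0 ->
  (forall (r : R) x y, M x -> M y -> M (r *: x + y)) ->
  (forall (r : R) x y, N x -> N y -> N (r *: x + y)) ->
  (forall z, exists x y, [/\ M x, N y & z = x + y]) ->
  (forall z, M z -> N z -> z = 0) ->
  exists2 c : R, 0 <= c & forall x y, M x -> N y -> `|x| <= c * `|x + y|.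
Proof.
move=> Mc Nc M0 N0 Ml Nl MN MN0.
have Mz r x : M x -> M (r *: x) by move=> Mx; rewrite -[_ *: _]addr0; exact: Ml.
have Nz r x : N x -> N (r *: x) by move=> Mx; rewrite -[_ *: _]addr0; exact: Nl.
have Md x y : M x -> M y -> M (x + y).
  by move=> Mx; rewrite -[x]scale1r; exact: Ml.
have Nd x y : N x -> N y -> N (x + y).
  by move=> Nx; rewrite -[x]scale1r; exact: Nl.
pose C k z := exists x y, [/\ M x, N y, z = x + y, `|x| <= k%:R & `|y| <= k%:R].
have C_all z : exists k, C k z.
  have [x [y [Mx Ny zE]]] := MN z.
  exists (maxn (Num.truncn `|x|).+1 (Num.truncn `|y|).+1), x, y.
  split=> //; rewrite natr_max le_max; apply/orP; [left|right];
    by rewrite ltW// truncnS_gt.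
have [k [z0 [r [r0 rC]]]] := Baire_closure C_all.
(* Symmetry and convexity of the k-bounded sums move the ball to the origin. *)
have ball0 w d : `|w| < r -> 0 < d -> exists x y,
    [/\ M x, N y, `|x| <= k%:R, `|y| <= k%:R & `|w - (x + y)| <= d].
  move=> wr d0.
  have [_ [x [y [Mx Ny -> xk yk]]] xyd] := closure_approx d0 (rC _ wr).
  have nwr : `|- w| < r by rewrite normrN.
  have [_ [x' [y' [Mx' Ny' -> xk' yk']]] xyd'] := closure_approx d0 (rC _ nwr).
  have half_le u v (c : R) : `|u| <= c -> `|v| <= c -> `|2^-1 *: (u - v)| <= c.
    move=> uc vc; rewrite normrZ ger0_norm ?invr_ge0// ler_pdivrMl//.
    by rewrite (le_trans (ler_normB _ _))//; lra.
  have MB u v : M u -> M v -> M (2^-1 *: (u - v)).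
    by move=> Mu Mv; apply: Mz; rewrite addrC -scaleN1r; exact: Ml.
  have NB u v : N u -> N v -> N (2^-1 *: (u - v)).
    by move=> Mu Mv; apply: Nz; rewrite addrC -scaleN1r; exact: Nl.
  exists (2^-1 *: (x - x')), (2^-1 *: (y - y')); split; rewrite ?half_le//.
  - exact: MB.
  - exact: NB.
  have -> : w - (2^-1 *: (x - x') + 2^-1 *: (y - y')) =
      2^-1 *: ((z0 + w - (x + y)) - (z0 - w - (x' + y'))).
    have {1}-> : w = 2^-1 *: (w + w).
      by rewrite -mulr2n -[w *+ 2]scaler_nat scalerA mulVf// scale1r.
    rewrite -scalerDr -scalerBr; congr (_ *: _).
    rewrite (addrACA x) -opprD [in RHS]opprB (addrC (x' + y')) [RHS]addrACA.
    by rewrite opprB [- (x + y) + _]addrC opprB (addrC (z0 + w)) subrKA.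
  exact: half_le.
pose K := k%:R * 2 / r.
have K0 : 0 <= K by rewrite divr_ge0 ?mulr_ge0// ltW.
have /choice[p pP] : forall w, exists p : V * V,
    [/\ M p.1, N p.2, `|p.1| <= K * `|w|, `|p.2| <= K * `|w| &
        `|w - (p.1 + p.2)| <= 2^-1 * `|w|].
  move=> w; have [->|w0] := eqVneq w 0.
    by exists (0, 0); split; rewrite /= ?addr0 ?subr0 ?normr0 ?mulr0.
  have nw0 : 0 < `|w| by rewrite normr_gt0.
  pose t := r / (2 * `|w|); have t0 : 0 < t by rewrite divr_gt0// mulr_gt0.
  have tw : `|t *: w| < r.
    rewrite normrZ gtr0_norm// (_ : t * _ = r / 2); first by lra.
    by rewrite /t; field; rewrite gt_eqF.
  have td : 0 < t * (2^-1 * `|w|) by rewrite mulr_gt0// mulr_gt0// invr_gt0.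
  have [x [y [Mx Ny xk yk xyd]]] := ball0 _ _ tw td.
  have tV u : `|u| <= k%:R -> `|t^-1 *: u| <= K * `|w|.
    move=> uk; rewrite normrZ normfV gtr0_norm// ler_pdivrMl//.
    rewrite (le_trans uk)// le_eqVlt; apply/orP; left; apply/eqP.
    by rewrite /t /K; field; rewrite !gt_eqF.
  exists (t^-1 *: x, t^-1 *: y); split; rewrite ?tV//; [exact: Mz|exact: Nz|].
  have -> : w - (t^-1 *: x + t^-1 *: y) = t^-1 *: (t *: w - (x + y)).
    by rewrite -scalerDr scalerBr scalerA mulVf ?gt_eqF// scale1r.
  by rewrite normrZ normfV gtr0_norm// ler_pdivrMl.
exists (2 * K); first by rewrite mulr_ge0.
move=> x y Mx Ny; set z := x + y.
pose w n := iter n (fun w => w - ((p w).1 + (p w).2)) z.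
have wS n : w n.+1 = w n - ((p (w n)).1 + (p (w n)).2) by [].
have w_le n : `|w n| <= `|z| * 2^-1 ^+ n.
  elim: n => [|n IH]; first by rewrite expr0 mulr1.
  have [_ _ _ _ wn] := pP (w n); rewrite wS (le_trans wn)//.
  by rewrite exprS mulrCA ler_wpM2l// invr_ge0.
have zE n : z = w n +
    (\sum_(0 <= i < n) (p (w i)).1 + \sum_(0 <= i < n) (p (w i)).2).
  elim: n => [|n IH]; first by rewrite !big_geq// !addr0.
  rewrite wS !big_nat_recr// (addrACA (\sum_(0 <= i < n) _)).
  by rewrite [X in _ = _ + X]addrC subrKA.
have Kz : 0 <= K * `|z| by rewrite mulr_ge0.
have M_sum n : M (series (fun n => (p (w n)).1) n).
  rewrite /series /=; elim/big_ind : _ => // i _.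
  by have [] := pP (w i).
have N_sum n : N (series (fun n => (p (w n)).2) n).
  rewrite /series /=; elim/big_ind : _ => // i _.
  by have [] := pP (w i).
have [X [MX Xz Xl]] : exists X, [/\ M X, `|X| <= 2 * (K * `|z|) &
    series (fun n => (p (w n)).1) @ \oo --> X].
  apply: geometric_cvg => // n; have [_ _ wn _ _] := pP (w n).
  by rewrite (le_trans wn)// -(mulrA K) ler_wpM2l.
have [Y [NY Yz Yl]] : exists X, [/\ N X, `|X| <= 2 * (K * `|z|) &
    series (fun n => (p (w n)).2) @ \oo --> X].
  apply: geometric_cvg => // n; have [_ _ _ wn _] := pP (w n).
  by rewrite (le_trans wn)// -(mulrA K) ler_wpM2l.
have XY : X + Y = z.
  have w_cvg : w @ \oo --> (0 : V).
    have /(_ `|z|) := @cvg_geometric R _ (2^-1).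
    have h1 : `|2^-1 : R| < 1 by rewrite ger0_norm ?invr_ge0//; lra.
    move=> /(_ h1) /cvgrPdist_le we; apply/cvgrPdist_le => e /we.
    apply: filterS => n; rewrite /= !sub0r !normrN => /(le_trans _); apply.
    by rewrite (le_trans (w_le n))// ler_norm.
  have := cvgD w_cvg (cvgD Xl Yl); rewrite add0r.
  have -> : w + (series (fun n => (p (w n)).1) +
      series (fun n => (p (w n)).2)) = (fun=> z).
    by apply/funext => n; rewrite [RHS](zE n).
  move=> /(_ _ _) wXY.
  exact: (cvg_unique (@norm_hausdorff _ V) wXY (@cvg_cst _ z _ _ _)).
suff -> : x = X by rewrite -(mulrA 2).
apply/subr0_eq/MN0.
  by rewrite addrC -scaleN1r; exact: Ml.
rewrite (_ : x - X = Y - y); first by rewrite addrC -scaleN1r; exact: Nl.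
by apply/eqP; rewrite subr_eq addrAC (addrC Y) XY addrK.
Qed.

End Banach.

(** * Submodules and finite generation *)

Section Submodules.
Context {R : realType} {A : cstarAlgType R}.
Implicit Types (x y z : ell2 A) (a : A) (M N : set (ell2 A)).
Implicit Types (F G : adjointable A).

Lemma submodule0 M : submodule M -> M 0.
Proof. by move=> [M0 _]; exact: M0. Qed.

Lemma submodule_mulrD M x y a :
  submodule M -> M x -> M y -> M (ell2_mulr x a + y).
Proof. by move=> [_ Ml] Mx My; apply: (Ml x y _ a). Qed.

Lemma submoduleD M x y : submodule M -> M x -> M y -> M (x + y).
Proof. by move=> sM Mx; rewrite -[x]ell2_mulr1; exact: submodule_mulrD. Qed.

Lemma submodule_mulr M x a : submodule M -> M x -> M (ell2_mulr x a).
Proof.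
move=> sM Mx; rewrite -[ell2_mulr _ _]addr0; apply: submodule_mulrD => //.
exact: submodule0.
Qed.

Lemma submoduleB M x y : submodule M -> M x -> M y -> M (x - y).
Proof. by move=> sM Mx My; apply: submoduleD => //; exact: submodule_mulr. Qed.

Lemma submodule_sum M (I : Type) (s : seq I) (f : I -> ell2 A) :
  submodule M -> (forall i, M (f i)) -> M (\sum_(i <- s) f i).
Proof.
move=> sM Mf; elim/big_rec : _ => [|i x _ Mx]; first exact: submodule0.
exact: submoduleD.
Qed.

Lemma submoduleI M : M 0 ->
  (forall x y a, M x -> M y -> M (ell2_mulr x a + y)) -> submodule M.
Proof.
move=> M0 Ml; split=> [z z0|x y z a Mx My zE].
  by rewrite (_ : z = 0)//; exact: ell2P.
by rewrite (_ : z = ell2_mulr x a + y); [exact: Ml|exact: ell2P].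
Qed.

Lemma direct_sum_decomp M N z : direct_sum M N ->
  exists x y, [/\ M x, N y & z = x + y].
Proof.
move=> [_ _ /(_ z)[x [y [Mx Ny zE]]] _].
by exists x, y; split=> //; exact: ell2P.
Qed.

Lemma direct_sum_cap M N z : direct_sum M N -> M z -> N z -> z = 0.
Proof. by move=> [_ _ _ /(_ z) MN] /MN z0 /z0 ?; exact: ell2P. Qed.

Lemma adjointable_mulrD F x y a :
  F (ell2_mulr x a + y) = ell2_mulr (F x) a + F y.
Proof. by apply: ell2P; exact: (adjointable_linear F). Qed.

Lemma adjointableD F x y : F (x + y) = F x + F y.
Proof. by rewrite -{1}[x]ell2_mulr1 adjointable_mulrD ell2_mulr1. Qed.

Lemma adjointable0 F : F 0 = 0.
Proof. by apply: (addrI (F 0)); rewrite -adjointableD !addr0. Qed.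

Lemma adjointable_mulr F x a : F (ell2_mulr x a) = ell2_mulr (F x) a.
Proof.
rewrite -[in LHS](addr0 (ell2_mulr _ _)) adjointable_mulrD.
by rewrite adjointable0 addr0.
Qed.

Lemma adjointableB F x y : F (x - y) = F x - F y.
Proof.
by rewrite adjointableD; congr (_ + _); exact: adjointable_mulr.
Qed.

Lemma adjointable_sum F (I : Type) (s : seq I) (f : I -> ell2 A) :
  F (\sum_(i <- s) f i) = \sum_(i <- s) F (f i).
Proof.
elim: s => [|i s IH]; first by rewrite !big_nil adjointable0.
by rewrite !big_cons adjointableD IH.
Qed.

Lemma finitely_generatedP N : finitely_generated N ->
  exists k (g : 'I_k -> ell2 A), forall x,
    N x <-> exists a : 'I_k -> A, x = \sum_(i < k) ell2_mulr (g i) (a i).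
Proof.
move=> [k [g NE]]; exists k, g => x; rewrite NE.
split=> -[a xa]; exists a; last by move=> n; rewrite xa ell2_sumE.
by apply: ell2P => n; rewrite ell2_sumE.
Qed.

(** Finite generation of a complement of [M] only depends on the quotient by
    [M]: project the generators. *)
Lemma finitely_generated_complement M N (I : finType) (h : I -> ell2 A) :
  direct_sum M N ->
  (forall x, N x -> exists (a : I -> A) y,
     M y /\ x = \sum_i ell2_mulr (h i) (a i) + y) ->
  finitely_generated N.
Proof.
move=> MN Nh; have [[sM _] [sN _] _ _] := MN.
have /choice[q hq] : forall i, exists p : ell2 A * ell2 A,
    [/\ M p.1, N p.2 & h i = p.1 + p.2].
  by move=> i; have [x [y xyP]] := direct_sum_decomp (h i) MN; exists (x, y).
pose g (i : 'I_#|I|) := (q (enum_val i)).2.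
have Ng (a : I -> A) : N (\sum_i ell2_mulr (q i).2 (a i)).
  by apply: submodule_sum => // i; apply: submodule_mulr => //; have [] := hq i.
exists #|I|, g; apply/seteqP; split=> x /=.
  move=> Nx; have [a [y [My xE]]] := Nh x Nx.
  have {}xE : x = \sum_i ell2_mulr (q i).2 (a i).
    apply/subr0_eq/(direct_sum_cap MN); last exact: submoduleB.
    rewrite xE addrAC -sumrB; apply: submoduleD => //.
    apply: submodule_sum => // i.
    have [Mq _ hE] := hq i.
    by rewrite hE ell2_mulrD addrK; exact: submodule_mulr.
  exists (fun i => a (enum_val i)) => n; rewrite {1}xE ell2_sumE.
  by rewrite (reindex _ (onW_bij _ (enum_val_bij I))).
move=> [a xE]; have -> : x = \sum_i ell2_mulr (q i).2 (a (enum_rank i)).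
  apply: ell2P => n; rewrite xE ell2_sumE.
  rewrite (reindex _ (onW_bij _ (enum_val_bij I)))/=.
  by apply: eq_bigr => i _; rewrite enum_valK.
exact: Ng.
Qed.

Lemma finitely_generated_other_complement M N N' :
  direct_sum M N -> direct_sum M N' -> finitely_generated N ->
  finitely_generated N'.
Proof.
move=> MN MN' /finitely_generatedP[k [g Ng]].
apply: (finitely_generated_complement (h := g) MN') => x _.
have [y [z [My /Ng[a ->] ->]]] := direct_sum_decomp x MN.
by exists a, y; rewrite addrC.
Qed.

Lemma decomposition_inj F M1 N1 M2 N2 x : decomposition F M1 N1 M2 N2 ->
  M1 x -> N2 (F x) -> x = 0.
Proof.
move=> [[[sM1 _] _ _ _] D2 FM _ [_ _ [_ F_inj _] _]] Mx NFx.
apply: F_inj; rewrite ?inE//; first exact: submodule0.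
rewrite adjointable0; apply: (direct_sum_cap D2) => //.
by apply: FM; exists x.
Qed.

Lemma decomposition_surj F M1 N1 M2 N2 y : decomposition F M1 N1 M2 N2 ->
  M2 y -> exists2 x, M1 x & F x = y.
Proof. by move=> [_ _ _ _ [_ _ [_ _ F_surj] _]] /F_surj. Qed.

(** Modulo [M2], every vector is in [F N1 + N2'] since [M2'] is in the range
    of [F] and [F M1] in [M2]. *)
Lemma MPhi_finitely_generated_codomain F M1 N1 M2 N2 :
  MPhi A F -> decomposition F M1 N1 M2 N2 ->
  finitely_generated N1 -> finitely_generated N2.
Proof.
move=> [M1' [N1' [M2' [N2' [FD' _ /finitely_generatedP[l [h N2h]]]]]]] FD.
move=> /finitely_generatedP[k [g N1g]].
have [D1 D2 FM _ _] := FD; have [_ D2' _ _ _] := FD'.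
pose gh (i : 'I_k + 'I_l) := match i with inl i => F (g i) | inr j => h j end.
apply: (finitely_generated_complement (h := gh) D2) => x _.
have [y [_ [My /N2h[b ->] ->]]] := direct_sum_decomp x D2'.
have [u _ <-] := decomposition_surj FD' My.
have [p [_ [Mp /N1g[a ->] ->]]] := direct_sum_decomp u D1.
exists (fun i => match i with inl i => a i | inr j => b j end), (F p).
split; first by apply: FM; exists p.
rewrite big_sumType/= adjointableD adjointable_sum [RHS]addrC addrA.
congr (_ + _ + _); apply: eq_bigr => i _.
by rewrite adjointable_mulr.
Qed.

(** The generators of [N2] are lifted along [F] modulo [N2']; the difference
    between [x] in [N1] and the lift of [F x] is in the preimage of [N2'],
    that is, in [N1']. *)
Lemma MPhi_finitely_generated_domain F M1 N1 M2 N2 :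
  MPhi A F -> decomposition F M1 N1 M2 N2 ->
  finitely_generated N2 -> finitely_generated N1.
Proof.
move=> [M1' [N1' [M2' [N2' [FD' /finitely_generatedP[l [h N1h]] _]]]]] FD.
move=> /finitely_generatedP[k [g N2g]].
have [D1 D2 _ FN _] := FD; have [D1' D2' _ FN' _] := FD'.
have [_ [sN2' _] _ _] := D2'.
have /choice[u gu] : forall i, exists u, N2' (g i - F u).
  move=> i; have [y [z [My Nz ->]]] := direct_sum_decomp (g i) D2'.
  by have [u _ <-] := decomposition_surj FD' My; exists u; rewrite addrC addKr.
pose uh (i : 'I_k + 'I_l) := match i with inl i => u i | inr j => h j end.
apply: (finitely_generated_complement (h := uh) D1) => x Nx.
have /N2g[a FxE] : N2 (F x) by apply: FN; exists x.
pose y := x - \sum_i ell2_mulr (u i) (a i).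
have NFy : N2' (F y).
  rewrite adjointableB FxE adjointable_sum -sumrB; apply: submodule_sum => // i.
  rewrite adjointable_mulr -ell2_mulrN -ell2_mulrD.
  exact: submodule_mulr.
have [m [n [Mm Nn yE]]] := direct_sum_decomp y D1'.
have m0 : m = 0.
  apply: (decomposition_inj FD') => //.
  rewrite -[m](addrK n) -yE adjointableB; apply: submoduleB => //.
  by apply: FN'; exists n.
have /N1h[b nE] := Nn.
exists (fun i => match i with inl i => a i | inr j => b j end), 0.
split; first by have [[/submodule0]] := D1.
have yn : y = n by rewrite yE m0 add0r.
by rewrite addr0 big_sumType/= -nE -yn [RHS]addrC subrK.
Qed.

End Submodules.

(** * Perturbation of a decomposition *)

Section Perturbation.
Context {R : realType} {A : cstarAlgType R}.
Implicit Types (x y z : ell2 A) (a : A) (M N : set (ell2 A)).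
Implicit Types (F G : adjointable A).

Lemma ell2_closedP M : closed M <->
  forall x, (forall e : R, 0 < e -> exists2 y, M y & hnorm (x - y) < e) -> M x.
Proof.
split=> [Mc x xM|Mx].
  have oM : dist_open (@ell2_dist R A) (~` M) := closed_openC Mc.
  apply: contrapT => nMx; have [e e0 eM] := oM x nMx.
  have [y My xy] := xM e e0; apply: (eM y) => //.
  by rewrite /ell2_dist hnorm_sub.
rewrite -(setCK M); apply: open_closedC.
suff : dist_open (@ell2_dist R A) (~` M) by [].
move=> x nMx.
apply: contrapT => no_ball; apply: nMx; apply: Mx => e e0.
apply: contrapT => no_y; apply: no_ball; exists e => // y xy My.
by apply: no_y; exists y => //; rewrite -hnorm_sub.
Qed.

Lemma hilbert_closedP (M : set (hilbert A)) : closed M <->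
  forall x, (forall e : R, 0 < e -> exists2 y, M y & hnorm (x - y) < e) -> M x.
Proof.
split=> [Mc x xM|Mx x xM].
  apply: Mc => B /nbhs_ballP[e /= e0 eB].
  have [y My xy] := xM e e0; exists y; split=> //; apply: eB.
  by rewrite -ball_normE.
apply: Mx => e e0; have [|y [My]] := xM (ball x e); first exact: nbhsx_ballx.
by rewrite -ball_normE /= => xy; exists y.
Qed.

Lemma adjointable_hnorm_le F :
  exists2 c : R, 0 <= c & forall x, hnorm (F x) <= c * hnorm x.
Proof.
have [c cF] := adjointable_bounded F; exists `|c| => // x.
by rewrite (le_trans (cF x I))// ler_wpM2r ?hnorm_ge0// ler_norm.
Qed.

Lemma op_dist_le F G x : hnorm (F x - G x) <= op_dist F G * hnorm x.
Proof.
have [b b0 Fb] := adjointable_hnorm_le F.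
have [c c0 Gc] := adjointable_hnorm_le G.
have ball_le y : hnorm y <= 1 -> hnorm (F y - G y) <= op_dist F G.
  move=> y1; rewrite -hnorm_sub; apply: sup_ubound; last by exists y.
  exists (b + c) => _ [w /= w1 <-]; rewrite hnorm_sub.
  rewrite (le_trans (ler_hnormD _ _))// hnorm_opp lerD//.
    by rewrite (le_trans (Fb w))// -[leRHS]mulr1 ler_wpM2l.
  by rewrite (le_trans (Gc w))// -[leRHS]mulr1 ler_wpM2l.
have [x0|x0] := eqVneq (hnorm x) 0.
  by rewrite (hnorm0_eq0 x0) !adjointable0 subrr hnorm_zero mulr0.
have x_gt0 : 0 < hnorm x by rewrite lt_def x0 hnorm_ge0.
have := ball_le (ell2_mulr x (sc (hnorm x)^-1)).
rewrite !adjointable_mulr -ell2_mulrN -ell2_mulrD !hnorm_scale normfV.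
by rewrite gtr0_norm// mulVf// => /(_ (lexx _)); rewrite ler_pdivrMl// mulrC.
Qed.

Lemma direct_sum_bounded M N : direct_sum M N ->
  exists2 c : R, 0 <= c &
    forall x y, M x -> N y -> hnorm x <= c * hnorm (x + y).
Proof.
move=> MN; have [[sM Mc] [sN Nc] _ _] := MN.
apply: (@closed_complement_bounded R (hilbert A) M N).
- exact/hilbert_closedP/ell2_closedP.
- exact/hilbert_closedP/ell2_closedP.
- exact: submodule0.
- exact: submodule0.
- by move=> r x y; exact: submodule_mulrD.
- by move=> r x y; exact: submodule_mulrD.
- by move=> z; exact: direct_sum_decomp.
- by move=> z; exact: direct_sum_cap MN.
Qed.

(** In block form, [G] near [F] still has an invertible first diagonal entry;
    but instead of block elimination the new summands are the image of [M1]
    and the preimage of [N2]. With [P] the composite of the projection onto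
    [M2] and the inverse of [F] on [M1], the operator [1 + (G - F) P] is a
    small perturbation of the identity that maps [M2] onto [G M1] and fixes
    [N2], so [G M1] and [N2] are again complementary. *)
Lemma decomposition_perturb F M1 N1 M2 N2 : decomposition F M1 N1 M2 N2 ->
  exists2 e : R, 0 < e & forall G, op_dist F G < e ->
    decomposition G M1 (G @^-1` N2) (G @` M1) N2.
Proof.
move=> FD; have [D1 D2 FM FN [_ _ _ [g [d0 gd] gK]]] := FD.
have [[sM1 M1c] _ _ _] := D1; have [[sM2 _] [sN2 N2c] _ _] := D2.
have [c c0 cM] := direct_sum_bounded D2.
pose d := `|d0|.
have M1_le x : M1 x -> hnorm x <= d * hnorm (F x).
  move=> Mx; rewrite -{1}(gK x) ?inE// (le_trans (gd _ _))//.
    by apply: FM; exists x.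
  by rewrite ler_wpM2r ?hnorm_ge0// ler_norm.
have d_ge0 : 0 <= d := normr_ge0 d0.
have cd0 : 0 <= c * d by rewrite mulr_ge0.
pose e := (2 * (c * d + 1))^-1.
have cd1 : 0 < c * d + 1 by rewrite ltr_wpDl.
have e0 : 0 < e by rewrite invr_gt0 mulr_gt0.
have ecd : e * (c * d) <= 2^-1.
  by rewrite mulrC ler_pdivrMr ?mulr_gt0//; lra.
exists e; [by []|move=> G Ge].
have FG x : hnorm (F x - G x) <= e * hnorm x.
  by rewrite (le_trans (op_dist_le F G x))// ler_wpM2r ?hnorm_ge0// ltW.
have FM1 x : M1 x -> M2 (F x) by move=> Mx; apply: FM; exists x.
(* The error term (F - G) x is absorbed since e * (c * d) <= 1 / 2. *)
have below x n : M1 x -> N2 n -> hnorm x <= 2 * (c * d) * hnorm (G x + n).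
  move=> Mx Nn; have := cM _ _ (FM1 _ Mx) Nn.
  have -> : F x + n = F x - G x + (G x + n) by rewrite subrKA.
  move=> Fx_le.
  have Fx_le' : hnorm (F x) <= c * (e * hnorm x + hnorm (G x + n)).
    rewrite (le_trans Fx_le)// ler_wpM2l//.
    by rewrite (le_trans (ler_hnormD _ _))// lerD2r.
  have := M1_le _ Mx; have := ler_wpM2l d_ge0 Fx_le'.
  have := ler_wpM2r (hnorm_ge0 x) ecd.
  lra.
have decomp z : exists x n, [/\ M1 x, N2 n & z = G x + n].
  (* p y is the vector of M1 that F maps to the M2-component of y. *)
  have /choice[p pP] : forall y, exists x, M1 x /\ N2 (y - F x).
    move=> y; have [m [n [Mm Nn ->]]] := direct_sum_decomp y D2.
    have [x Mx <-] := decomposition_surj FD Mm.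
    by exists x; split=> //; rewrite addrC addKr.
  have [] := @contraction_add_surj R (hilbert A)
    (fun y => G (p y) - F (p y)) 2^-1 _ _ _ z.
  - by rewrite invr_ge0.
  - by lra.
  - move=> y w; rewrite !hilbert_normE.
    have [Mp Np] := pP y; have [Mq Nq] := pP w.
    have Mpq : M1 (p y - p w) by exact: submoduleB.
    have Npq : N2 (y - w - F (p y - p w)).
      have -> : y - w - F (p y - p w) = (y - F (p y)) - (w - F (p w)).
        by rewrite adjointableB !opprB addrACA [- w + _]addrC -addrACA.
      exact: submoduleB.
    have := cM _ _ (FM1 _ Mpq) Npq; rewrite (addrC (F _)) subrK => pq_le.
    have -> : G (p y) - F (p y) - (G (p w) - F (p w)) =
        - (F (p y - p w) - G (p y - p w)).
      rewrite !adjointableB !opprB (addrC (F (p w)) (- _)).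
      by rewrite addrACA (addrC (- F (p y))).
    rewrite hnorm_opp (le_trans (FG _))//.
    have := M1_le _ Mpq; have := ler_wpM2l d_ge0 pq_le.
    have := ler_wpM2r (hnorm_ge0 (y - w)) ecd.
    have := hnorm_ge0 (p y - p w); move: (hnorm (p y - p w)) => u u0 ? ? ?.
    have : e * u <= e * (d * (c * hnorm (y - w))).
      by rewrite ler_wpM2l ?(ltW e0)//; lra.
    lra.
  - move=> y yE; have [Mp Np] := pP y; exists (p y), (y - F (p y)); split=> //.
    by rewrite {1}yE [RHS]addrC addrAC addrA.
have N1_inj x n : M1 x -> N2 n -> G x + n = 0 -> x = 0.
  move=> Mx Nn Gxn; apply: hnorm0_eq0; apply/eqP.
  rewrite eq_le hnorm_ge0 andbT.
  by have := below _ _ Mx Nn; rewrite Gxn hnorm_zero mulr0.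
have [b b0 Gb] := adjointable_hnorm_le G.
have GM1_sub : submodule (G @` M1).
  apply: submoduleI.
    by exists 0; [exact: submodule0|exact: adjointable0].
  move=> _ _ a [x Mx <-] [y My <-]; exists (ell2_mulr x a + y).
    exact: submodule_mulrD.
  exact: adjointable_mulrD.
have GM1_closed : closed (G @` M1).
  apply/ell2_closedP => z zM.
  have [x [n [Mx Nn zE]]] := decomp z.
  suff n0 : n = 0 by exists x => //; rewrite zE n0 addr0.
  apply: hnorm0_eq0; apply/eqP; rewrite eq_le hnorm_ge0 andbT.
  apply/ler_addgt0Pr => r r0; rewrite add0r.
  pose s := 1 + b * (2 * (c * d)).
  have s0 : 0 < s by rewrite ltr_pwDl// !mulr_ge0.
  have [|_ [y My <-] zy] := zM (r / s); first by rewrite divr_gt0.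
  have := below _ _ (submoduleB sM1 Mx My) Nn.
  have GxyE : G (x - y) + n = z - G y by rewrite adjointableB zE addrAC.
  rewrite GxyE => xy_le.
  have -> : n = (z - G y) - G (x - y) by rewrite -GxyE addrC addKr.
  rewrite (le_trans (ler_hnormD _ _))// hnorm_opp.
  apply: (@le_trans _ _ (s * hnorm (z - G y))); last first.
    by rewrite mulrC -ler_pdivlMr// ltW.
  by rewrite mulrDl mul1r lerD// (le_trans (Gb _))// -(mulrA b) ler_wpM2l.
have GN2_sub : submodule (G @^-1` N2).
  apply: submoduleI => [|x y a /= Nx Ny].
    by rewrite /preimage /= adjointable0; exact: submodule0.
  by rewrite adjointable_mulrD; exact: submodule_mulrD.
have GN2_closed : closed (G @^-1` N2).
  apply/ell2_closedP => x xN; move/ell2_closedP : N2c; apply => r r0.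
  have b1 : 0 < b + 1 by rewrite ltr_wpDl.
  have [|y Ny xy] := xN (r / (b + 1)); first by rewrite divr_gt0.
  exists (G y) => //; rewrite -adjointableB (le_lt_trans (Gb _))//.
  move: xy; rewrite ltr_pdivlMr//.
  have := hnorm_ge0 (x - y); nra.
split.
- split=> //.
  + move=> z; have [x [n [Mx Nn zE]]] := decomp (G z).
    exists x, (z - x); split=> //.
      by rewrite /preimage /= adjointableB zE addrC addKr.
    by move=> k; rewrite -ell2_addE addrC subrK.
  + move=> z Mz Nz k; rewrite (N1_inj z (- G z))// ?subrr//.
    exact: submodule_mulr.
- split=> //.
  + move=> z; have [x [n [Mx Nn zE]]] := decomp z.
    by exists (G x), n; split=> //; rewrite zE.
  + move=> _ [x Mx <-] Nx k.
    rewrite (N1_inj x (- G x)) ?adjointable0// ?subrr//.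
    exact: submodule_mulr.
- by [].
- by move=> _ [x Nx <-].
- have G_inj : {in M1 &, injective G}.
    move=> x y; rewrite !inE => Mx My xy; apply/subr0_eq.
    apply: (N1_inj _ 0 (submoduleB sM1 Mx My)); first exact: submodule0.
    by rewrite addr0 adjointableB xy subrr.
  split.
  + by move=> x y z a Mx My Mz; exact: (adjointable_linear G).
  + by exists b.
  + exact: inj_bij.
  have /choice[h hG] : forall w, exists x, (G @` M1) w -> M1 x /\ G x = w.
    move=> w; have [[x Mx <-]|nw] := pselect ((G @` M1) w).
      by exists x.
    by exists 0.
  exists h; last first.
    move=> x; rewrite inE => Mx; have [|Mh hx] := hG (G x); first by exists x.
    by apply: G_inj; rewrite ?inE.
  exists (2 * (c * d)) => w Gw; have [Mh hw] := hG w Gw.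
  by have := below _ 0 Mh (submodule0 sN2); rewrite addr0 hw.
Qed.

End Perturbation.

(** * Open sets of operators *)

Section Openness.
Context {R : realType} {A : cstarAlgType R}.
Implicit Types (F G : adjointable A) (S : set (adjointable A)).

Lemma adjointable_open S :
  (forall F, S F -> exists2 e : R, 0 < e & forall G, op_dist F G < e -> S G) ->
  open S.
Proof. by move=> oS; suff : dist_open (@op_dist R A) S by []. Qed.

(** Both [N1] and the new summand are complements of the same [M1]. *)
Lemma decomposition_perturb_domain F M1 N1 M2 N2 :
  decomposition F M1 N1 M2 N2 ->
  exists2 e : R, 0 < e & forall G, op_dist F G < e ->
    exists N1' M2', decomposition G M1 N1' M2' N2 /\
      (finitely_generated N1 <-> finitely_generated N1').
Proof.
move=> FD; have [e e0 eG] := decomposition_perturb FD; exists e => // G /eG GD.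
exists (G @^-1` N2), (G @` M1); split=> //.
have [D1 _ _ _ _] := FD; have [D1' _ _ _ _] := GD.
by split; [exact: (finitely_generated_other_complement D1 D1')|
  exact: (finitely_generated_other_complement D1' D1)].
Qed.

Lemma MPhi_open : open (MPhi A).
Proof.
apply: adjointable_open => F [M1 [N1 [M2 [N2 [FD fg1 fg2]]]]].
have [e e0 eG] := decomposition_perturb_domain FD.
exists e => // G /eG[N1' [M2' [GD fgE]]].
by exists M1, N1', M2', N2; split=> //; exact: (iffLR fgE).
Qed.

(** A nearby operator in [MPhi] would have a finitely generated summand in
    its domain, hence [N2], which is common to both decompositions, would be
    finitely generated. *)
Lemma MPhi_plus_diff_open : open (MPhi_plus A `\` MPhi A).
Proof.
apply: adjointable_open => F [[M1 [N1 [M2 [N2 [FD fg1]]]]] nF].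
have [e e0 eG] := decomposition_perturb_domain FD.
exists e => // G /eG[N1' [M2' [GD /iffLR/(_ fg1) fg1']]]; split.
  by exists M1, N1', M2', N2.
move=> GM; apply: nF; exists M1, N1, M2, N2; split=> //.
exact: MPhi_finitely_generated_codomain GM GD fg1'.
Qed.

Lemma MPhi_minus_diff_open : open (MPhi_minus A `\` MPhi A).
Proof.
apply: adjointable_open => F [[M1 [N1 [M2 [N2 [FD fg2]]]]] nF].
have [e e0 eG] := decomposition_perturb_domain FD.
exists e => // G /eG[N1' [M2' [GD fgE]]]; split.
  by exists M1, N1', M2', N2.
move=> GM; apply: nF; exists M1, N1, M2, N2; split=> //.
exact: (iffRL fgE (MPhi_finitely_generated_domain GM GD fg2)).
Qed.

End Openness.

Theorem corollary4p2 (R : realType) (A : cstarAlgType R) (F : adjointable A) :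
  boundary (MPhi A) F -> ~ MPhi_pm A F.
Proof.
move=> [clF nintF] pmF.
have nF : ~ MPhi A F.
  move=> MF; apply: nintF; apply: open_nbhs_nbhs; split=> //.
  exact: MPhi_open.
have disjoint S : open (S `\` MPhi A) -> S F -> False.
  move=> oS SF; have [|G [GM []]] := clF (S `\` MPhi A) => //.
  by apply: open_nbhs_nbhs.
case: pmF; apply: disjoint.
- exact: MPhi_plus_diff_open.
- exact: MPhi_minus_diff_open.
Qed.
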